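(* Let $k\ge 1$ be an integer. For $1\le n\le k-1$ let $F_{k-1}^{n}=\partial_x H_k^{2n}-(\partial_x H_k^{2n+1})\,e_{12}$, and let $F_{k-1}^{0}=\partial_x H_k^{0}$, where the $H_k^j$ are the explicit solid spherical harmonics on $\mathbb{R}^3$ given in the context. Then the functions $\{F_{k-1}^{n}\}_{n=0}^{k-1}$ form an orthogonal basis for $\mathcal{M}_{\ell}^{+}(k-1)$ in $\mathbb{R}^3$; that is, they belong to $\mathcal{M}_{\ell}^{+}(k-1)$, they form a basis of it as a right $\mathbb{R}_3$-module, and $$\int_{S^2}\overline{F_{k-1}^{n}(\omega)}\,F_{k-1}^{n'}(\omega)\,d\omega=0\qquad\text{whenever } n\neq n'.$$
   Context: $\mathbb{R}_3$ is the real Clifford algebra of dimension $8$ generated by $e_1,e_2,e_3$ with $e_j^2=-1$ and $e_ie_j=-e_je_i$ for $i\ne j$; $e_{ij}=e_ie_j$. The conjugation $\lambda\mapsto\bar\lambda$ is the real-linear map with $\overline{\lambda\mu}=\bar\mu\bar\lambda$, $\overline{1}=1$ and $\overline{e_j}=-e_j$. The Dirac operator is $\partial_x=\sum_{j=1}^3 e_j\partial_{x_j}$, acting from the left. $\mathcal{M}_\ell^+(k)$ is the right $\mathbb{R}_3$-module of $\mathbb{R}_3$-valued polynomials on $\mathbb{R}^3$ that are homogeneous of degree $k$ and satisfy $\partial_x f=0$ (left solid inner spherical monogenics of degree $k$). Such homogeneous functions are identified with their restrictions to the unit sphere $S^2$, and $d\omega$ is surface measure on $S^2$. Spherical coordinates: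 $x=(r\cos\theta\sin\phi,\ r\sin\theta\sin\phi,\ r\cos\phi)$ with $r\ge 0$, $0\le\theta<2\pi$, $0\le\phi\le\pi$. Jacobi polynomials: $P_N^{(\alpha,\beta)}(x)=2^{-N}\sum_{s=0}^N\binom{N+\alpha}{N-s}\binom{N+\beta}{s}(x-1)^s(x+1)^{N-s}$. The spherical harmonics of degree $k$ are $$H_k^0(x)=\frac{r^k}{\sqrt{8\pi}}P_k^{(0,0)}(\cos\phi),$$ $$H_k^{2n}(x)=\frac{r^k}{2^{n+1}\sqrt\pi}(\sin\phi)^nP_{k-n}^{(n,n)}(\cos\phi)\cos n\theta,\qquad H_k^{2n+1}(x)=\frac{r^k}{2^{n+1}\sqrt\pi}(\sin\phi)^nP_{k-n}^{(n,n)}(\cos\phi)\sin n\theta\quad(1\le n\le k).$$ *)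

(* Defs.v *)
From HB Require Import structures.
From mathcomp Require Import all_boot all_order all_algebra.
From mathcomp Require Import all_classical all_reals all_analysis.
From mathcomp Require Import ring.

Set Implicit Arguments.
Unset Strict Implicit.
Unset Printing Implicit Defensive.

Import Order.TTheory GRing.Theory Num.Theory.
Import numFieldNormedType.Exports.

Local Open Scope ring_scope.

(** * The real Clifford algebra with [n] generators of square [-1]

An element is the family of its coordinates in the basis
[e_A = e_i1 * ... * e_ir] with [A = {i1 < ... < ir}]; the generators are
numbered from [0], so [e_1, e_2, e_3] are [cl_gen 0, 1, 2]. *)

Definition symdiff (n : nat) (A B : {set 'I_n}) : {set 'I_n} :=
  [set i | (i \in A) (+) (i \in B)].

(** [e_A * e_B = (-1) ^ N e_(symdiff A B)], where [N] counts the pairs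
[i > j] with [i] in [A] and [j] in [B] (each is one transposition) and the
common indices [i = j] (each contributes [e_i ^ 2 = -1]). *)
Definition cl_sign (n : nat) (A B : {set 'I_n}) : bool :=
  odd #|[set p : 'I_n * 'I_n | [&& p.1 \in A, p.2 \in B & (p.2 <= p.1)%N]]|.

Definition clifford (R : realType) (n : nat) : Type := {ffun {set 'I_n} -> R}.

Section CliffordAlgebra.
Variables (R : realType) (n : nat).
Implicit Types (A B C : {set 'I_n}).
Local Notation Cl := (clifford R n).

HB.instance Definition _ := GRing.Lmodule.copy Cl {ffun {set 'I_n} -> R}.

Definition blade A : Cl := [ffun B => (B == A)%:R].
Definition cl_mul (a b : Cl) : Cl :=
  \sum_A \sum_B ((-1) ^+ cl_sign A B * a A * b B) *: blade (symdiff A B).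

Lemma odd_card_symdiff (T : finType) (P Q : {set T}) :
  odd #|[set x | (x \in P) (+) (x \in Q)]| = odd #|P| (+) odd #|Q|.
Proof.
have -> : [set x | (x \in P) (+) (x \in Q)] = (P :\: Q) :|: (Q :\: P).
  by apply/setP => x; rewrite !inE; do 2!case: (_ \in _).
rewrite cardsU -(cardsID Q P) -(cardsID P Q) (finset.setIC Q P).
have -> : (P :\: Q) :&: (Q :\: P) = finset.set0.
  by apply/setP => x; rewrite !inE; do 2!case: (_ \in _).
by rewrite cards0 subn0 !oddD; do 3!case: (odd _).
Qed.

Lemma cl_signDl A B C : cl_sign (symdiff A B) C = cl_sign A C (+) cl_sign B C.
Proof.
rewrite /cl_sign -odd_card_symdiff; congr (odd #|pred_of_set _|).
apply/setP => p; rewrite !inE.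
by case: (p.1 \in A); case: (p.1 \in B); case: (p.2 \in C); case: (p.2 <= p.1)%N.
Qed.

Lemma cl_signDr A B C : cl_sign C (symdiff A B) = cl_sign C A (+) cl_sign C B.
Proof.
rewrite /cl_sign -odd_card_symdiff; congr (odd #|pred_of_set _|).
apply/setP => p; rewrite !inE.
by case: (p.2 \in A); case: (p.2 \in B); case: (p.1 \in C); case: (p.2 <= p.1)%N.
Qed.

Lemma cl_sign0l A : cl_sign finset.set0 A = false.
Proof.
rewrite /cl_sign (_ : [set _ | _] = finset.set0) ?cards0//.
by apply/setP => p; rewrite !inE.
Qed.

Lemma cl_sign0r A : cl_sign A finset.set0 = false.
Proof.
rewrite /cl_sign (_ : [set _ | _] = finset.set0) ?cards0//.
by apply/setP => p; rewrite !inE andbF.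
Qed.

Lemma symdiffA : associative (@symdiff n).
Proof. by move=> A B C; apply/setP => i; rewrite !inE addbA. Qed.

Lemma symdiff0l : left_id finset.set0 (@symdiff n).
Proof. by move=> A; apply/setP => i; rewrite !inE. Qed.

Lemma symdiff0r : right_id finset.set0 (@symdiff n).
Proof. by move=> A; apply/setP => i; rewrite !inE addbF. Qed.

Lemma cl_addE (a b : Cl) A : (a + b) A = a A + b A.
Proof. by rewrite ffunE. Qed.

Lemma cl_scaleE t (a : Cl) A : (t *: a) A = t * a A.
Proof. by rewrite ffunE. Qed.

Lemma cl_sumE (I : Type) (r : seq I) (P : pred I) (F : I -> Cl) A :
  (\sum_(i <- r | P i) F i) A = \sum_(i <- r | P i) F i A.
Proof. exact: sum_ffunE. Qed.

Lemma bladeE A B : blade A B = (B == A)%:R.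
Proof. by rewrite ffunE. Qed.

Lemma blade_decomp (a : Cl) : a = \sum_A a A *: blade A.
Proof.
apply/ffunP => C.
rewrite cl_sumE (bigD1 C)//= cl_scaleE bladeE eqxx mulr1 big1 ?addr0//.
by move=> A nAC; rewrite cl_scaleE bladeE eq_sym (negbTE nAC) mulr0.
Qed.

Lemma cl_mulDl : left_distributive cl_mul +%R.
Proof.
move=> a b c; rewrite /cl_mul -big_split/=; apply: eq_bigr => A _.
by rewrite -big_split/=; apply: eq_bigr => B _; rewrite -scalerDl cl_addE mulrDr mulrDl.
Qed.

Lemma cl_mulDr : right_distributive cl_mul +%R.
Proof.
move=> a b c; rewrite /cl_mul -big_split/=; apply: eq_bigr => A _.
by rewrite -big_split/=; apply: eq_bigr => B _; rewrite -scalerDl cl_addE mulrDr.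
Qed.

Lemma cl_mulZl t (a b : Cl) : t *: cl_mul a b = cl_mul (t *: a) b.
Proof.
rewrite /cl_mul scaler_sumr; apply: eq_bigr => A _; rewrite scaler_sumr.
by apply: eq_bigr => B _; rewrite scalerA cl_scaleE; congr (_ *: _);
   rewrite !mulrA (mulrC t).
Qed.

Lemma cl_mulZr t (a b : Cl) : t *: cl_mul a b = cl_mul a (t *: b).
Proof.
rewrite /cl_mul scaler_sumr; apply: eq_bigr => A _; rewrite scaler_sumr.
by apply: eq_bigr => B _; rewrite scalerA cl_scaleE; congr (_ *: _);
   rewrite mulrCA !mulrA.
Qed.

Lemma cl_mul0l (a : Cl) : cl_mul 0 a = 0.
Proof. by have := cl_mulZl 0 0 a; rewrite !scale0r. Qed.

Lemma cl_mul0r (a : Cl) : cl_mul a 0 = 0.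
Proof. by have := cl_mulZr 0 a 0; rewrite !scale0r. Qed.

Lemma cl_mul_suml (I : Type) (r : seq I) (F : I -> Cl) (b : Cl) :
  cl_mul (\sum_(i <- r) F i) b = \sum_(i <- r) cl_mul (F i) b.
Proof.
by elim: r => [|i r IH]; rewrite ?big_nil ?cl_mul0l// !big_cons cl_mulDl IH.
Qed.

Lemma cl_mul_sumr (I : Type) (r : seq I) (F : I -> Cl) (b : Cl) :
  cl_mul b (\sum_(i <- r) F i) = \sum_(i <- r) cl_mul b (F i).
Proof.
by elim: r => [|i r IH]; rewrite ?big_nil ?cl_mul0r// !big_cons cl_mulDr IH.
Qed.

Lemma cl_mul_blade A B :
  cl_mul (blade A) (blade B) = (-1) ^+ cl_sign A B *: blade (symdiff A B).
Proof.
rewrite /cl_mul (bigD1 A)//= [X in _ + X]big1 ?addr0; last first.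
  move=> C CA; rewrite big1// => D _.
  by rewrite bladeE (negbTE CA) mulr0 mul0r scale0r.
rewrite (bigD1 B)//= [X in _ + X]big1 ?addr0; last first.
  by move=> C CB; rewrite [blade B C]bladeE (negbTE CB) mulr0 scale0r.
by rewrite !bladeE !eqxx !mulr1.
Qed.

Lemma cl_mul_bladeA A B C :
  cl_mul (blade A) (cl_mul (blade B) (blade C)) =
  cl_mul (cl_mul (blade A) (blade B)) (blade C).
Proof.
rewrite !cl_mul_blade -cl_mulZr -cl_mulZl !cl_mul_blade !scalerA symdiffA.
rewrite -!signr_addb cl_signDl cl_signDr.
by case: (cl_sign A B); case: (cl_sign B C); case: (cl_sign A C).
Qed.

Lemma cl_mulA : associative cl_mul.
Proof.
move: cl_mulZl cl_mulZr cl_mul_suml cl_mul_sumr cl_mul_bladeA.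
move: cl_mul => m mZl mZr m_suml m_sumr m_bladeA.
have bladeA2 A B c :
    m (blade A) (m (blade B) c) = m (m (blade A) (blade B)) c.
  rewrite (blade_decomp c) !m_sumr; apply: eq_bigr => C _.
  by rewrite -!mZr m_bladeA.
have bladeA1 A b c : m (blade A) (m b c) = m (m (blade A) b) c.
  rewrite (blade_decomp b) m_suml !m_sumr m_suml.
  by apply: eq_bigr => B _; rewrite -mZl -!mZr -mZl bladeA2.
move=> a b c; rewrite (blade_decomp a) !m_suml.
by apply: eq_bigr => A _; rewrite -!mZl bladeA1.
Qed.

Lemma cl_mul1l : left_id (blade finset.set0) cl_mul.
Proof.
move=> a; rewrite {1}(blade_decomp a) [RHS]blade_decomp cl_mul_sumr.
by apply: eq_bigr => A _; rewrite -cl_mulZr cl_mul_blade cl_sign0l symdiff0l scale1r.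
Qed.

Lemma cl_mul1r : right_id (blade finset.set0) cl_mul.
Proof.
move=> a; rewrite {1}(blade_decomp a) [RHS]blade_decomp cl_mul_suml.
by apply: eq_bigr => A _; rewrite -cl_mulZl cl_mul_blade cl_sign0r symdiff0r scale1r.
Qed.

Lemma cl_1_neq0 : blade finset.set0 != 0 :> Cl.
Proof.
by apply/eqP => /ffunP/(_ finset.set0)/eqP; rewrite !ffunE eqxx oner_eq0.
Qed.

HB.instance Definition _ := GRing.Zmodule_isNzRing.Build Cl
  cl_mulA cl_mul1l cl_mul1r cl_mulDl cl_mulDr cl_1_neq0.
HB.instance Definition _ := GRing.Lmodule_isLalgebra.Build R Cl cl_mulZl.
HB.instance Definition _ := GRing.Lalgebra_isAlgebra.Build R Cl cl_mulZr.

Definition cl_gen (i : 'I_n) : Cl := blade [set i].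

(** Reversing [e_A] takes [r (r - 1) / 2] transpositions, [r = #|A|], and each
of the [r] generators changes sign. *)
Definition cl_conj (a : Cl) : Cl :=
  [ffun A : {set 'I_n} => (-1) ^+ (#|A| * #|A|.+1)./2 * a A].

Lemma blade0 : blade finset.set0 = 1 :> Cl.
Proof. by []. Qed.

Lemma blade_mul A B :
  blade A * blade B = (-1) ^+ cl_sign A B *: blade (symdiff A B) :> Cl.
Proof. exact: cl_mul_blade. Qed.

Lemma cl_sign1 (i j : 'I_n) : cl_sign [set i] [set j] = (j <= i)%N.
Proof.
rewrite /cl_sign; case: leqP => ji.
  rewrite (_ : [set _ | _] = [set (i, j)]) ?cards1//.
  apply/setP => -[x y]; rewrite !inE/= xpair_eqE.
  by case: eqP => //= ->; case: eqP => //= ->; rewrite ji.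
rewrite (_ : [set _ | _] = finset.set0) ?cards0//.
apply/setP => -[x y]; rewrite !inE/=.
by case: eqP => //= ->; case: eqP => //= ->; rewrite leqNgt ji.
Qed.

Lemma cl_gen_sqr (i : 'I_n) : cl_gen i * cl_gen i = -1.
Proof.
rewrite blade_mul cl_sign1 leqnn expr1 scaleN1r -blade0; congr (- blade _).
by apply/setP => j; rewrite !inE addbb.
Qed.

Lemma cl_gen_anticomm (i j : 'I_n) : i != j ->
  cl_gen i * cl_gen j = - (cl_gen j * cl_gen i).
Proof.
move=> ij; rewrite !blade_mul !cl_sign1 (_ : symdiff _ _ = symdiff [set j] [set i]).
  have: (i : nat) != j by [].
  by case: ltngtP => //= _ _; rewrite !(expr0, expr1) scaleN1r scale1r ?opprK.
by apply/setP => x; rewrite !inE addbC.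
Qed.

Lemma blade_prod_gen (s : seq 'I_n) :
  sorted (fun i j : 'I_n => i < j)%N s ->
  blade [set i in s] = \prod_(i <- s) cl_gen i.
Proof.
have tr : transitive (fun i j : 'I_n => (i < j)%N) by move=> y x z; apply: ltn_trans.
elim: s => [_|i s IH /= pis].
  by rewrite big_nil -blade0; congr blade; apply/setP => x; rewrite !inE.
have lei (j : 'I_n) : j \in s -> (i < j)%N.
  by move: j; apply/allP; apply: order_path_min pis.
rewrite big_cons -IH ?(path_sorted pis)// blade_mul.
rewrite (_ : cl_sign _ _ = false) ?scale1r.
  congr blade; apply/setP => x; rewrite !inE.
  by case: eqP => [->|//]; case: (boolP (i \in s)) => // /lei; rewrite ltnn.
rewrite /cl_sign [X in #|pred_of_set X|](_ : _ = finset.set0) ?cards0//.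
apply/setP => -[x y]; rewrite !inE/=; case: eqP => //= ->.
by case: (boolP (y \in s)) => //= /lei; rewrite ltnNge => /negbTE.
Qed.

Lemma cl_signC A B :
  cl_sign A B (+) cl_sign B A = odd (#|A| * #|B|) (+) odd #|A :&: B|.
Proof.
pose T := ('I_n * 'I_n)%type.
have -> : cl_sign B A =
    odd #|[set p : T | [&& p.1 \in A, p.2 \in B & (p.1 <= p.2)%N]]|.
  rewrite /cl_sign -(card_imset _ (inv_inj (@swap_pairK _ _)))/=.
  congr (odd #|pred_of_set _|); apply/setP => -[x y]; rewrite !inE/=.
  apply/imsetP/and3P => [[[u v]]|[xA yB xy]].
    by rewrite !inE/= => /and3P[? ? ?] [-> ->].
  by exists (y, x) => //; rewrite !inE/=; apply/and3P.
rewrite -cardsX /cl_sign -!oddD -cardsUI; congr (odd (_ + _)).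
  congr #|pred_of_set _|; apply/setP => -[x y]; rewrite !inE/=.
  by case: (x \in A); case: (y \in B) => //=; apply: leq_total.
rewrite -(card_imset (A :&: B) (f := fun x => (x, x))); last by move=> ? ? [].
congr #|pred_of_set _|; apply/setP => -[x y]; rewrite !inE/=.
apply/andP/imsetP => [[/and3P[xA yB yx] /and3P[_ _ xy]]|[z]].
  have xEy : x = y by apply/val_inj/eqP; rewrite eqn_leq yx xy.
  by exists x; rewrite ?inE ?xA xEy.
by rewrite inE => /andP[zA zB] [-> ->]; rewrite zA zB leqnn.
Qed.

Lemma odd_halfD (m k : nat) :
  odd ((m + k) * (m + k).+1)./2 =
  odd (m * m.+1)./2 (+) odd (k * k.+1)./2 (+) (odd m && odd k).
Proof.
have -> : ((m + k) * (m + k).+1 = m * m.+1 + k * k.+1 + (m * k).*2)%N.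
  by rewrite -mul2n; ring.
have ev j : odd (j * j.+1) = false by rewrite oddM/= andbN.
rewrite -oddM; move: (ev m) (ev k); move: (m * m.+1)%N (k * k.+1)%N (m * k)%N.
move=> a b c ea eb.
by rewrite halfD odd_double andbF add0n doubleK halfD ea add0n !oddD.
Qed.

Lemma cl_conj_sign A B :
  let q (C : {set 'I_n}) := odd (#|C| * #|C|.+1)./2 in
  q (symdiff A B) (+) cl_sign A B = q A (+) q B (+) cl_sign B A.
Proof.
move=> /=; have := cl_signC A B; rewrite oddM.
have -> : #|symdiff A B| = (#|A :\: B| + #|B :\: A|)%N.
  rewrite -cardsUI [X in (_ + #|pred_of_set X|)%N](_ : _ = finset.set0).
    rewrite cards0 addn0; congr #|pred_of_set _|.
    by apply/setP => x; rewrite !inE; do 2!case: (_ \in _).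
  by apply/setP => x; rewrite !inE; do 2!case: (_ \in _).
rewrite -(cardsID B A) -(cardsID A B) (finset.setIC B A) !odd_halfD !oddD.
by case: (cl_sign A B); case: (cl_sign B A); case: (odd #|A :&: B|);
  case: (odd #|A :\: B|); case: (odd #|B :\: A|);
  do 3!case: (odd (_ * _)./2).
Qed.

Lemma cl_conj_linear : linear cl_conj.
Proof.
move=> t a b; apply/ffunP => A.
by rewrite !(cl_addE, cl_scaleE, ffunE) mulrDr mulrCA.
Qed.

HB.instance Definition _ :=
  GRing.isLinear.Build R Cl Cl *:%R cl_conj cl_conj_linear.

Lemma cl_conj_blade A :
  cl_conj (blade A) = (-1) ^+ odd (#|A| * #|A|.+1)./2 *: blade A.
Proof.
apply/ffunP => B; rewrite ffunE cl_scaleE bladeE signr_odd.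
by case: eqP => [->//|_]; rewrite !mulr0.
Qed.

Lemma cl_conj1 : cl_conj 1 = 1.
Proof. by rewrite -blade0 cl_conj_blade cards0 scale1r. Qed.

Lemma cl_conj_gen (i : 'I_n) : cl_conj (cl_gen i) = - cl_gen i.
Proof. by rewrite cl_conj_blade cards1 scaleN1r. Qed.

Lemma cl_conjM (a b : Cl) : cl_conj (a * b) = cl_conj b * cl_conj a.
Proof.
have bladeM A B : cl_conj (blade A * blade B) = cl_conj (blade B) * cl_conj (blade A).
  rewrite blade_mul linearZ/= !cl_conj_blade -scalerAl -scalerAr blade_mul.
  rewrite (_ : symdiff B A = symdiff A B); last first.
    by apply/setP => x; rewrite !inE addbC.
  by rewrite !scalerA -!signr_addb addbC cl_conj_sign; congr ((-1) ^+ nat_of_bool _ *: _);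
     case: (odd _); case: (odd _); case: (cl_sign B A).
rewrite (blade_decomp a) (blade_decomp b) mulr_suml !linear_sum/= mulr_sumr.
apply: eq_bigr => A _; rewrite mulr_sumr linear_sum mulr_suml; apply: eq_bigr => B _.
by rewrite -scalerAl -scalerAr !linearZ/= -scalerAl -scalerAr bladeM !scalerA mulrC.
Qed.

End CliffordAlgebra.

(** * Monogenic polynomials on the three-dimensional space *)

Section Monogenic.
Variable R : realType.
Local Notation E := 'rV[R]_3.
Local Notation Cl := (clifford R 3).

(** [m] ranges over the exponents of the monomials of degree [k]. *)
Definition homogeneous_poly (k : nat) (f : E -> Cl) : Prop :=
  exists c : {ffun 'I_3 -> 'I_k.+1} -> Cl, forall x,
    f x = \sum_(m : {ffun 'I_3 -> 'I_k.+1} | (\sum_(i < 3) m i)%N == k)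
            (\prod_(i < 3) x 0 i ^+ m i) *: c m.

Definition partial (j : 'I_3) (f : E -> Cl) (x : E) : Cl :=
  [ffun A : {set 'I_3} => 'D_(delta_mx 0 j) (fun y => f y A) x].

Definition dirac_op (f : E -> Cl) (x : E) : Cl :=
  \sum_(j < 3) cl_gen R j * partial j f x.

Definition inner_monogenic (k : nat) : set (E -> Cl) :=
  [set f | homogeneous_poly k f /\ forall x, dirac_op f x = 0]%classic.

Definition right_basis (m : nat) (M : set (E -> Cl)) (F : 'I_m -> E -> Cl) : Prop :=
  [/\ forall n, M (F n),
      forall f, M f -> exists a : 'I_m -> Cl, forall x, f x = \sum_n F n x * a n &
      forall a : 'I_m -> Cl, (forall x, \sum_n F n x * a n = 0) -> forall n, a n = 0].

Definition spherical (r theta phi : R) : E :=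
  \row_(j < 3) [:: r * cos theta * sin phi; r * sin theta * sin phi; r * cos phi]`_j.

Definition is_spherical_coord (x : E) (p : R * R * R) : Prop :=
  let: (r, theta, phi) := p in
  [/\ 0 <= r, 0 <= theta < 2 * pi, 0 <= phi <= pi & x = spherical r theta phi].

Definition spherical_coord (x : E) : R * R * R :=
  xget (0, 0, 0) [set p | is_spherical_coord x p]%classic.

Lemma spherical_coordP (x : E) : is_spherical_coord x (spherical_coord x).
Proof.
suff [p xp] : exists p, is_spherical_coord x p by apply: (xgetPex _ (ex_intro _ p xp)).
pose a := x 0 0; pose b := x 0 1; pose c := x 0 (inord 2).
have xE r theta phi : a = r * cos theta * sin phi -> b = r * sin theta * sin phi ->
    c = r * cos phi -> x = spherical r theta phi.
  move=> ha hb hc; apply/rowP => j; rewrite mxE.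
  case: j => -[|[|[|//]]] hj /=; [rewrite -ha|rewrite -hb|rewrite -hc];
    by congr (x _ _); apply/val_inj; rewrite //= inordK.
pose rho := Num.sqrt (a ^+ 2 + b ^+ 2); pose r := Num.sqrt (rho ^+ 2 + c ^+ 2).
have rho0 : 0 <= rho by exact: sqrtr_ge0.
have rho2 : rho ^+ 2 = a ^+ 2 + b ^+ 2 by rewrite sqr_sqrtr// addr_ge0// sqr_ge0.
have r0 : 0 <= r by exact: sqrtr_ge0.
have r2 : r ^+ 2 = rho ^+ 2 + c ^+ 2 by rewrite sqr_sqrtr// addr_ge0// sqr_ge0.
have ratio (u v w : R) : 0 <= w -> w ^+ 2 = u ^+ 2 + v ^+ 2 -> -1 <= v / w <= 1.
  move=> w0 w2; rewrite -ler_norml normrM normfV (ger0_norm w0).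
  have [->|wn0] := eqVneq w 0; first by rewrite invr0 mulr0.
  rewrite ler_pdivrMr ?lt0r ?wn0// mul1r -(ger0_norm w0) -ler_sqr ?nnegrE//.
  by rewrite !real_normK ?num_real// w2 lerDr sqr_ge0.
have [theta [th0 ath bth]] : exists theta,
    [/\ 0 <= theta < 2 * pi, a = rho * cos theta & b = rho * sin theta].
  have := pi_gt0 R => pi0.
  have [rhoE|rhon0] := eqVneq rho 0.
    exists 0; rewrite rhoE !mul0r lexx mulr_gt0//.
    move: rho2; rewrite rhoE expr0n/= => /esym/eqP.
    by rewrite paddr_eq0 ?sqr_ge0// !sqrf_eq0 => /andP[/eqP-> /eqP->].
  have rq : -1 <= a / rho <= 1 by apply: (@ratio b) => //; rewrite rho2 addrC.
  have s : rho * sin (acos (a / rho)) = `|b|.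
    rewrite sin_acos// -[X in X * _](ger0_norm rho0) -sqrtr_sqr -sqrtrM ?sqr_ge0//.
    rewrite -[RHS]sqrtr_sqr; congr Num.sqrt.
    rewrite mulrBr mulr1 exprMn exprVn mulrCA mulfV ?expf_neq0// mulr1 rho2.
    by rewrite addrAC subrr add0r.
  have ca : a = rho * cos (acos (a / rho)) by rewrite acosK ?in_itv//= mulrC divfK.
  have ge := acos_ge0 rq; have le := acos_lepi rq.
  have [b0|b0] := leP 0 b.
    exists (acos (a / rho)); split => //; last by rewrite s ger0_norm.
    by rewrite ge/= (le_lt_trans le)// mulr_natl mulr2n ltrDl.
  exists (2 * pi - acos (a / rho)); split.
  - apply/andP; split; first by rewrite subr_ge0 (le_trans le)// mulr_natl mulr2n lerDl ltW.
    rewrite ltrBlDr ltrDl lt_neqAle ge andbT eq_sym; apply/eqP => ac0.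
    by move: s; rewrite ac0 sin0 mulr0 => /esym/eqP; rewrite normr_eq0 lt_eqF.
  - by rewrite addrC mulr_natl cosD2pi cosN.
  - by rewrite addrC mulr_natl sinD2pi sinN mulrN s ltr0_norm ?opprK.
have rq : -1 <= c / r <= 1 by apply: (@ratio rho).
have [rE|rn0] := eqVneq r 0.
  exists (0, theta, 0); split => //; first by rewrite lexx pi_ge0.
  move: r2; rewrite rE expr0n/= => /esym/eqP.
  rewrite paddr_eq0 ?sqr_ge0// !sqrf_eq0 => /andP[/eqP rhoE /eqP cE].
  by apply: xE; rewrite ?cE ?mul0r// ?ath ?bth rhoE mul0r.
have s : r * sin (acos (c / r)) = rho.
  rewrite sin_acos// -[X in X * _](ger0_norm r0) -sqrtr_sqr -sqrtrM ?sqr_ge0//.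
  rewrite -[RHS](ger0_norm rho0) -[RHS]sqrtr_sqr; congr Num.sqrt.
  rewrite mulrBr mulr1 exprMn exprVn mulrCA mulfV ?expf_neq0// mulr1 r2.
  by rewrite addrK.
exists (r, theta, acos (c / r)); split => //.
  by rewrite acos_ge0// acos_lepi.
apply: xE; [by rewrite mulrAC s|by rewrite mulrAC s|].
by rewrite acosK ?in_itv//= mulrC divfK.
Qed.

(** Only natural parameters [a], [b] occur below. *)
Definition jacobi (N a b : nat) : {poly R} :=
  (2 ^+ N)^-1 *: \sum_(s < N.+1)
    ('C(N + a, N - s) * 'C(N + b, s))%:R *: (('X - 1) ^+ s * ('X + 1) ^+ (N - s)).

(** [solid_harmonic k j] is [H_k^j].  For [k >= 1] the value does not depend on
the spherical coordinates selected where they are not unique, namely on the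
third axis.  The index [j = 1] is not used (the formula gives [0]). *)
Definition solid_harmonic (k j : nat) (x : E) : R :=
  let: (r, theta, phi) := spherical_coord x in
  let n := j./2 in
  if j == 0 then r ^+ k / Num.sqrt (8 * pi) * (jacobi k 0 0).[cos phi]
  else r ^+ k / (2 ^+ n.+1 * Num.sqrt pi) * sin phi ^+ n
       * (jacobi (k - n) n n).[cos phi]
       * (if odd j then sin (n%:R * theta) else cos (n%:R * theta)).

Definition dirac_harmonic (k j : nat) : E -> Cl :=
  dirac_op (fun x => (solid_harmonic k j x)%:A).

(** [basis_fun k n] is [F_(k-1)^n], of degree [k - 1]. *)
Definition basis_fun (k n : nat) : E -> Cl :=
  if n == 0 then dirac_harmonic k 0
  else fun x => dirac_harmonic k n.*2 x
                - dirac_harmonic k n.*2.+1 x * (cl_gen R 0 * cl_gen R 1).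

(** Surface integral over the unit sphere, parametrized by
[(theta, phi) |-> spherical 1 theta phi] with area element [sin phi]. *)
Definition sphere_integral (g : E -> Cl) : Cl :=
  [ffun A : {set 'I_3} =>
    \int[(@lebesgue_measure R \x @lebesgue_measure R)%E]_(p in
        (`[0, 2 * pi] `*` `[0, pi])%classic)
      (g (spherical 1 p.1 p.2) A * sin p.2)].

End Monogenic.

Arguments inner_monogenic : clear implicits.
Arguments basis_fun : clear implicits.

(* Main.v *)
(** With [J = e_1 e_2] and [w = x_1 - x_2 J], the combination
[H_k^(2n) - H_k^(2n+1) J] is a multiple of
[psi = \sum_j (-1/4)^j x_3^[k-n-2j] w^[j+n] wbar^[j]], where [y^[m] = y^m / m!];
this is Vandermonde's identity applied to the Jacobi polynomial with equal
parameters.  On such divided powers [partial_3], [partial_1 + J partial_2] and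
[partial_1 - J partial_2] act by shifting exponents, so [F_(k-1)^n], the Dirac
derivative of [psi], is again explicit, and visibly monogenic.

A monogenic homogeneous polynomial is determined by its restriction to the plane
[x_3 = 0], where [F_(k-1)^n] is [w^b wbar^(k-1-b)] times an invertible constant
and [b] runs over [0, ..., k-1] as [n] does.  These monomials form a right basis
of the polynomials of degree [k-1] on the plane, whence the basis property.

On the sphere [w] is [sin phi] times the rotor [exp (- theta J)], and moving the
rotors past [e_1] and [e_3] shows that the integrand for [n <> n'] only involves
nonzero frequencies in [theta]. *)
From HB Require Import structures.
Require Import Defs.
From mathcomp Require Import all_boot all_order all_algebra.
From mathcomp Require Import all_classical all_reals all_analysis.
From mathcomp Require Import measurable_realfun ring lra zify.

Import Order.TTheory GRing.Theory Num.Theory.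
Import numFieldNormedType.Exports.
Local Open Scope ring_scope.

Set Implicit Arguments.
Unset Strict Implicit.
Unset Printing Implicit Defensive.

Lemma big_ord3 (V : nmodType) (F : 'I_3 -> V) : \sum_i F i = F 0 + F 1 + F 2.
Proof.
rewrite !big_ord_recl big_ord0 addr0 addrA.
by congr (F _ + F _ + F _); apply: val_inj.
Qed.

(** * Partial derivatives of Clifford-valued functions *)

Section Differentiation.
Variable R : realType.
Local Notation E := 'rV[R]_3.
Local Notation Cl := (clifford R 3).
Implicit Types (f g : E -> Cl) (c d e : Cl) (x : E) (j : 'I_3).

Lemma cl_mulE c d A :
  (c * d) A = \sum_B \sum_C (-1) ^+ cl_sign B C * (A == symdiff B C)%:R * (c B * d C).
Proof.
rewrite (_ : c * d = cl_mul c d)// /cl_mul cl_sumE; apply: eq_bigr => B _.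
rewrite cl_sumE; apply: eq_bigr => C _; rewrite cl_scaleE bladeE.
by rewrite -!mulrA; congr (_ * _); rewrite [RHS]mulrC mulrA.
Qed.

(** The operator [partial] returns a value even where a coordinate is not differentiable. This
    relation also records differentiability, so that the rules below compose. *)
Definition is_partial j f x d : Prop :=
  forall A, is_derive x (delta_mx 0 j) (fun y => f y A) (d A).

Lemma is_partialE j f x d : is_partial j f x d -> partial j f x = d.
Proof. by move=> fd; apply/ffunP => A; rewrite ffunE; apply: derive_val. Qed.

Lemma is_partial_eq j f x d e : is_partial j f x d -> d = e -> is_partial j f x e.
Proof. by move=> ? <-. Qed.

Lemma is_partial_cst j x c : is_partial j (fun=> c) x 0.
Proof. by move=> A; rewrite ffunE; apply: is_derive_cst. Qed.

Lemma is_partialD j f g x d e : is_partial j f x d -> is_partial j g x e ->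
  is_partial j (fun y => f y + g y) x (d + e).
Proof.
move=> fd ge A; rewrite (_ : (fun y => _) = (fun y => f y A) + (fun y => g y A)).
  by rewrite ffunE; apply: is_deriveD; [apply: fd|apply: ge].
by apply/funext => y; rewrite ffunE.
Qed.

Lemma is_derive_bigsum (I : finType) (V : normedModType R) (h : I -> V -> R)
    (x v : V) (dh : I -> R) : (forall i, is_derive x v (h i) (dh i)) ->
  is_derive x v (fun y => \sum_i h i y) (\sum_i dh i).
Proof.
move=> hd; rewrite (_ : (fun y => _) = \sum_i h i); last first.
  by apply/funext => y; rewrite fct_sumE.
elim/big_rec2: _ => [|i df f _ ih]; first exact: is_derive_cst.
exact: is_deriveD.
Qed.

(** By [cl_mulE] each coordinate of a product is bilinear, with constant coefficients, in the
    coordinates of the factors, so the real product rule applies; the order of the factors is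
    kept. *)
Lemma is_partialM j f g x d e : is_partial j f x d -> is_partial j g x e ->
  is_partial j (fun y => f y * g y) x (d * g x + f x * e).
Proof.
move=> fd ge A.
rewrite (_ : (fun y => _) = fun y => \sum_B \sum_C
  (-1) ^+ cl_sign B C * (A == symdiff B C)%:R * (f y B * g y C)); last first.
  by apply/funext => y; rewrite cl_mulE.
rewrite ffunE !cl_mulE -big_split/=.
apply: is_derive_bigsum => B; rewrite -big_split/=; apply: is_derive_bigsum => C.
rewrite -mulrDr addrC.
apply: (is_deriveZ (f := fun y => f y B * g y C)).
have := is_deriveM (fd B) (ge C); move/is_derive_eq; apply.
by rewrite /GRing.scale/= [X in _ + X]mulrC.
Qed.

Lemma is_partialMr j f x c d : is_partial j f x d ->
  is_partial j (fun y => f y * c) x (d * c).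
Proof.
move=> fd; have := is_partialM fd (is_partial_cst j x c).
by move/is_partial_eq; apply; rewrite mulr0 addr0.
Qed.

Lemma is_partialMl j f x c d : is_partial j f x d ->
  is_partial j (fun y => c * f y) x (c * d).
Proof.
move=> fd; have := is_partialM (is_partial_cst j x c) fd.
by move/is_partial_eq; apply; rewrite mul0r add0r.
Qed.

Lemma is_partialZ j f x t d : is_partial j f x d ->
  is_partial j (fun y => t *: f y) x (t *: d).
Proof.
move=> /(is_partialMl t%:A); rewrite mulr_algl.
by under eq_fun do rewrite mulr_algl.
Qed.

Lemma is_partialN j f x d : is_partial j f x d ->
  is_partial j (fun y => - f y) x (- d).
Proof.
move=> /(is_partialZ (-1)); rewrite scaleN1r.
by under eq_fun do rewrite scaleN1r.
Qed.

Lemma is_partialB j f g x d e : is_partial j f x d -> is_partial j g x e ->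
  is_partial j (fun y => f y - g y) x (d - e).
Proof. by move=> fd /is_partialN; apply: is_partialD. Qed.

Lemma is_partial_sum (I : Type) (r : seq I) (P : pred I) j (F : I -> E -> Cl)
    (D : I -> Cl) x :
  (forall i, P i -> is_partial j (F i) x (D i)) ->
  is_partial j (fun y => \sum_(i <- r | P i) F i y) x (\sum_(i <- r | P i) D i).
Proof.
move=> FD; elim: r => [|i r ih].
  by rewrite big_nil; under eq_fun do rewrite big_nil; apply: is_partial_cst.
rewrite big_cons; under eq_fun do rewrite big_cons.
by case: ifP => // Pi; apply: is_partialD => //; apply: FD.
Qed.

Lemma is_derive_coord (i j : 'I_3) x :
  is_derive x (delta_mx 0 j) (fun y : E => y 0 i) (i == j)%:R.
Proof.
have lin : linear (fun y : E => y 0 i : R^o) by move=> t y z; rewrite !mxE.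
pose L := GRing.isLinear.Build _ _ _ _ _ lin.
pose h : {linear E -> R^o} := HB.pack (fun y : E => y 0 i : R^o) L.
have cts : continuous (h : E -> R^o) by move=> y; apply: coord_continuous.
have df : differentiable (h : E -> R^o) x by apply: linear_differentiable.
apply: DeriveDef; first exact: diff_derivable.
rewrite (deriveE _ (f := h)) // diff_lin //= /h/= mxE eqxx/=.
by [].
Qed.

Lemma is_partial_coord (i j : 'I_3) x :
  is_partial j (fun y => (y 0 i)%:A) x ((i == j)%:R)%:A.
Proof.
move=> A; rewrite cl_scaleE mulrC.
rewrite (_ : (fun y => _) = (fun y : E => (1 : Cl) A * y 0 i)).
  by have := is_deriveZ ((1 : Cl) A) (is_derive_coord i j x).
by apply/funext => y; rewrite cl_scaleE mulrC.
Qed.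

Lemma is_partialXl (i j : 'I_3) f x d : is_partial j f x d ->
  is_partial j (fun y => y 0 i *: f y) x ((i == j)%:R *: f x + x 0 i *: d).
Proof.
move=> /(is_partialM (is_partial_coord i j x)); rewrite !mulr_algl.
by under eq_fun do rewrite mulr_algl.
Qed.

End Differentiation.

(** * Homogeneous polynomials and uniqueness of monogenic extensions *)

Section HomogeneousPolynomials.
Variable R : realType.
Local Notation E := 'rV[R]_3.
Local Notation Cl := (clifford R 3).
Implicit Types (f g : E -> Cl) (c d : Cl) (x : E).

(** This form allows induction on the degree; the [g i] need not be unique. [hpol_poly] identifies
    it with [homogeneous_poly]. *)
Fixpoint hpol (N : nat) f : Prop :=
  if N is N'.+1 then
    exists2 g : 'I_3 -> E -> Cl, (forall i, hpol N' (g i)) &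
      f = fun x => \sum_i x 0 i *: g i x
  else exists c, f = fun=> c.

Lemma hpol_cst c : hpol 0 (fun=> c).
Proof. by exists c. Qed.

Lemma hpol0 N : hpol N (fun=> 0).
Proof.
elim: N => [|N ih]; first exact: hpol_cst.
by exists (fun i _ => 0) => //; apply/funext => x; rewrite big1// => i _; rewrite scaler0.
Qed.

Lemma hpolD N f g : hpol N f -> hpol N g -> hpol N (fun x => f x + g x).
Proof.
elim: N f g => [|N ih] f g.
  by move=> [c ->] [d ->]; exists (c + d).
move=> [u hu ->] [v hv ->]; exists (fun i x => u i x + v i x).
  by move=> i; apply: ih; [apply: hu|apply: hv].
apply/funext => x; rewrite -big_split/=; apply: eq_bigr => i _.
by rewrite scalerDr.
Qed.

Lemma hpol_sum (I : Type) (r : seq I) (P : pred I) N (F : I -> E -> Cl) :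
  (forall i, P i -> hpol N (F i)) -> hpol N (fun x => \sum_(i <- r | P i) F i x).
Proof.
move=> FN; elim: r => [|i r ih].
  by under eq_fun do rewrite big_nil; apply: hpol0.
under eq_fun do rewrite big_cons.
by case: (boolP (P i)) => // Pi; apply: hpolD => //; apply: FN.
Qed.

Lemma hpolMl c N f : hpol N f -> hpol N (fun x => c * f x).
Proof.
elim: N f => [|N ih] f.
  by move=> [d ->]; exists (c * d).
move=> [u hu ->]; exists (fun i x => c * u i x); first by move=> i; apply: ih (hu i).
by apply/funext => x; rewrite mulr_sumr; apply: eq_bigr => i _; rewrite scalerAr.
Qed.

Lemma hpolM M N f g : hpol M f -> hpol N g -> hpol (M + N) (fun x => f x * g x).
Proof.
elim: M f => [|M ih] f.
  by move=> [c ->]; apply: hpolMl.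
move=> [u hu ->] hg; exists (fun i x => u i x * g x); first by move=> i; apply: ih (hu i) hg.
by apply/funext => x; rewrite mulr_suml; apply: eq_bigr => i _; rewrite scalerAl.
Qed.

Lemma hpolMr c N f : hpol N f -> hpol N (fun x => f x * c).
Proof. by move=> fN; rewrite -[N]addn0; apply: hpolM => //; apply: hpol_cst. Qed.

Lemma hpolZ t N f : hpol N f -> hpol N (fun x => t *: f x).
Proof.
by move=> /(hpolMl t%:A); under eq_fun do rewrite mulr_algl.
Qed.

Lemma hpolN N f : hpol N f -> hpol N (fun x => - f x).
Proof.
by move=> /(hpolZ (-1)); under eq_fun do rewrite scaleN1r.
Qed.

Lemma hpolB N f g : hpol N f -> hpol N g -> hpol N (fun x => f x - g x).
Proof. by move=> fN /hpolN; apply: hpolD. Qed.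

Lemma hpol_coord i : hpol 1 (fun x => (x 0 i)%:A).
Proof.
exists (fun j _ => (i == j)%:R%:A); first by move=> j; apply: hpol_cst.
apply/funext => x; rewrite (bigD1 i)//= eqxx scale1r big1 ?addr0// => j ji.
by rewrite eq_sym (negbTE ji) scale0r scaler0.
Qed.

Lemma hpolXn M f n : hpol M f -> hpol (M * n) (fun x => f x ^+ n).
Proof.
move=> fM; elim: n => [|n ih].
  by rewrite muln0; under eq_fun do rewrite expr0; apply: hpol_cst.
by rewrite mulnS; under eq_fun do rewrite exprS; apply: hpolM.
Qed.

(** Used for the scalar coordinate, to see that the solid harmonics are polynomials. *)
Lemma hpol_coef N f A : hpol N f -> hpol N (fun x => (f x A)%:A).
Proof.
elim: N f => [|N ih] f; first by move=> [c ->]; exists (c A)%:A.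
move=> [u hu ->]; exists (fun i x => (u i x A)%:A); first by move=> i; apply: ih (hu i).
apply/funext => x; rewrite cl_sumE scaler_suml; apply: eq_bigr => i _.
by rewrite cl_scaleE scalerA.
Qed.

Lemma hpol_poly N f : homogeneous_poly N f <-> hpol N f.
Proof.
split.
  move=> [c fc]; have -> : f = (fun x : E =>
      \sum_(m : {ffun 'I_3 -> 'I_N.+1} | (\sum_(i < 3) m i)%N == N)
            (\prod_(i < 3) x 0 i ^+ m i) *: c m) by apply/funext.
  apply: hpol_sum => m /eqP mN.
  have -> : (fun x : E => (\prod_(i < 3) x 0 i ^+ m i) *: c m) =
     (fun x => (x 0 0)%:A ^+ m 0 * (x 0 1)%:A ^+ m 1 * (x 0 2)%:A ^+ m 2 * c m).
    apply/funext => x; rewrite -3!in_algE -!rmorphXn -!rmorphM/= mulr_algl.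
    congr (_ *: _); rewrite !big_ord_recl big_ord0 mulr1 mulrA.
    by congr (x 0 _ ^+ m _ * x 0 _ ^+ m _ * x 0 _ ^+ m _); apply: val_inj.
  apply: hpolMr; rewrite [X in hpol X _](_ : N = 1 * m 0%R + 1 * m 1%R + 1 * m 2%R)%N.
    by do 2?apply: hpolM; apply: hpolXn; apply: hpol_coord.
  rewrite -[LHS]mN !big_ord_recl big_ord0 addn0 addnA !mul1n.
  by congr (_ + _ + _)%N; congr (nat_of_ord (m _)); apply: val_inj.
have hom0 M : homogeneous_poly M (fun=> 0 : Cl).
  by exists (fun=> 0) => x; rewrite big1// => m _; rewrite scaler0.
have homD M (u v : E -> Cl) : homogeneous_poly M u -> homogeneous_poly M v ->
    homogeneous_poly M (fun x => u x + v x).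
  move=> [c uc] [d vd]; exists (fun m => c m + d m) => x.
  by rewrite uc vd -big_split; apply: eq_bigr => m _; rewrite scalerDr.
have hom_sum (I : Type) (r : seq I) (P : pred I) M (F : I -> E -> Cl) :
    (forall i, P i -> homogeneous_poly M (F i)) ->
    homogeneous_poly M (fun x => \sum_(i <- r | P i) F i x).
  move=> FN; elim: r => [|i r ih].
    by under eq_fun do rewrite big_nil; apply: hom0.
  under eq_fun do rewrite big_cons.
  by case: (boolP (P i)) => // Pi; apply: homD => //; apply: FN.
(* A single monomial; its exponents sum to [M], so none exceeds [M] and [inord] returns them
   unchanged. *)
have mono M (e : 'I_3 -> nat) (c : Cl) : (\sum_i e i)%N = M ->
    homogeneous_poly M (fun x => (\prod_(i < 3) x 0 i ^+ e i) *: c).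
  move=> eM; pose m : {ffun 'I_3 -> 'I_M.+1} := [ffun i => inord (e i)].
  have mE i : m i = e i :> nat.
    by rewrite ffunE inordK// ltnS -eM (bigD1 i)//= leq_addr.
  exists (fun m' => if m' == m then c else 0) => x.
  rewrite (bigD1 m) /=; last by rewrite -[X in _ == X]eM; under eq_bigr do rewrite mE.
  rewrite eqxx [X in _ + X]big1 ?addr0; last first.
    by move=> m' /andP[_ /negbTE->]; rewrite scaler0.
  by congr (_ *: _); apply: eq_bigr => i _; rewrite mE.
elim: N f => [|N ih] f.
  move=> [c ->]; rewrite (_ : (fun=> c) = fun x : E => (\prod_(i < 3) x 0 i ^+ 0) *: c).
    by apply: (mono 0%N (fun=> 0%N)); rewrite big1.
  by apply/funext => x; rewrite big1 ?scale1r.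
move=> [u hu ->]; apply: (hom_sum) => i _; have [c uc] := ih _ (hu i).
under eq_fun do rewrite uc scaler_sumr.
apply: hom_sum => m /eqP mN.
rewrite (_ : (fun x => _) = fun x : E => (\prod_l x 0 l ^+ ((i == l) + m l)) *: c m).
  apply: (mono _ (fun l => (i == l) + m l)%N).
  by rewrite big_split/= mN (bigD1 i)//= eqxx big1// => j /negbTE; rewrite eq_sym => ->.
apply/funext => x; rewrite scalerA; congr (_ *: _).
under [RHS]eq_bigr do rewrite exprD.
rewrite big_split/=; congr (_ * _); rewrite (bigD1 i)//= eqxx expr1 big1 ?mulr1//.
by move=> j /negbTE; rewrite eq_sym => ->.
Qed.

Lemma hpol_partial0 f j x : hpol 0 f -> is_partial j f x 0.
Proof. by move=> [c ->]; apply: is_partial_cst. Qed.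

Lemma hpol_partialP N f j : hpol N.+1 f ->
  exists2 g, hpol N g & forall x, is_partial j f x (g x).
Proof.
elim: N f => [|N ih] f [u hu ->].
  exists (u j) => // x.
  have := @is_partial_sum R _ (index_enum 'I_3) predT j (fun i y => y 0 i *: u i y) _ x
    (fun i _ => is_partialXl i (hpol_partial0 j x (hu i))).
  move/is_partial_eq; apply; rewrite (bigD1 j)//= eqxx scale1r scaler0 addr0.
  by rewrite big1 ?addr0// => i /negbTE->; rewrite scaler0 addr0 scale0r.
have /choice[v vP] (i : 'I_3) :
    exists w, hpol N w /\ forall x, is_partial j (u i) x (w x).
  by have [w wN wP] := ih _ (hu i); exists w.
exists (fun x => \sum_i ((i == j)%:R *: u i x + x 0 i *: v i x)).
  under eq_fun do rewrite big_split/=.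
  apply: hpolD; last by exists v => // i; case: (vP i).
  by apply: hpol_sum => i _; apply: hpolZ; apply: hu.
by move=> x; apply: is_partial_sum => i _; apply: is_partialXl; case: (vP i).
Qed.

Lemma hpol_partial N f j : hpol N.+1 f -> hpol N (partial j f).
Proof.
move=> /(hpol_partialP j) [g gN fg].
by rewrite (_ : partial j f = g)//; apply/funext => x; apply: is_partialE.
Qed.

Lemma hpolP N f j x : hpol N f -> is_partial j f x (partial j f x).
Proof.
case: N => [|N] fN.
  by rewrite (is_partialE (hpol_partial0 j x fN)); apply: hpol_partial0.
by have [g _ fg] := hpol_partialP j fN; rewrite (is_partialE (fg x)).
Qed.

Lemma partial_hpolS N (u : 'I_3 -> E -> Cl) j x : (forall i, hpol N (u i)) ->
  partial j (fun x => \sum_i x 0 i *: u i x) x =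
  u j x + \sum_i x 0 i *: partial j (u i) x.
Proof.
move=> hu.
have := @is_partial_sum R _ (index_enum 'I_3) predT j (fun i y => y 0 i *: u i y) _ x
    (fun i _ => is_partialXl i (hpolP j x (hu i))).
move/is_partialE => ->; rewrite big_split/=; congr (_ + _).
by rewrite (bigD1 j)//= eqxx scale1r big1 ?addr0// => i /negbTE->; rewrite scale0r.
Qed.

(** In the product rule, the terms where a factor [x 0 i] is differentiated add up to [f]; the
    others give the multiple known by induction. *)
Lemma euler_hpol N f x : hpol N f ->
  \sum_j x 0 j *: partial j f x = N%:R *: f x.
Proof.
elim: N f => [|N ih] f fN.
  by rewrite scale0r big1// => j _; rewrite (is_partialE (hpol_partial0 j x fN)) scaler0.
move: fN => [u hu ->].
under eq_bigr do rewrite (partial_hpolS _ _ hu) scalerDr.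
rewrite big_split/= mulrS scalerDl scale1r; congr (_ + _).
under eq_bigr do rewrite scaler_sumr.
rewrite exchange_big/= scaler_sumr; apply: eq_bigr => i _.
rewrite [RHS]scalerA mulrC -scalerA -(ih _ (hu i)) scaler_sumr.
by apply: eq_bigr => j _; rewrite !scalerA mulrC.
Qed.

(** For f = sum x_i u_i the product rule gives d_l d_m f = d_l u_m + d_m u_l + sum x_i d_l d_m u_i,
    which is symmetric in l and m by induction on the degree. *)
Lemma partialC N f (i j : 'I_3) x : hpol N f ->
  partial i (partial j f) x = partial j (partial i f) x.
Proof.
elim: N f => [|N ih] f fN.
  have p0 l : partial l f = fun=> 0.
    by apply/funext => y; apply/is_partialE/hpol_partial0.
  by rewrite !p0 (is_partialE (is_partial_cst _ _ _)) (is_partialE (is_partial_cst _ _ _)).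
move: fN => [u hu ->].
have aux l m : partial l (partial m (fun x => \sum_i x 0 i *: u i x)) x =
    partial l (u m) x + partial m (u l) x + \sum_i x 0 i *: partial l (partial m (u i)) x.
  rewrite (_ : partial m _ = fun y => u m y + \sum_i y 0 i *: partial m (u i) y); last first.
    by apply/funext => y; rewrite (partial_hpolS _ _ hu).
  apply: is_partialE; rewrite -addrA; apply: is_partialD; first exact: hpolP (hu m).
  have h k y : is_partial l (partial m (u k)) y (partial l (partial m (u k)) y).
    case: (N) (hu k) => [|M] hM; last by apply/hpolP/hpol_partial/hM.
    have -> : partial m (u k) = fun=> 0.
      by apply/funext => z; apply/is_partialE/hpol_partial0.
    by rewrite (is_partialE (is_partial_cst _ _ _)); apply: is_partial_cst.
  have := @is_partial_sum R _ (index_enum 'I_3) predT l (fun i y => y 0 i *: partial m (u i) y)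
   _ x (fun i _ => is_partialXl i (h i x)).
  move/is_partial_eq; apply; rewrite big_split/=; congr (_ + _).
  by rewrite (bigD1 l)//= eqxx scale1r big1 ?addr0// => k /negbTE->; rewrite scale0r.
apply: (etrans (aux i j)); apply/esym/(etrans (aux j i)).
apply: (f_equal2 +%R); first by rewrite addrC.
by apply: eq_bigr => k _; rewrite (ih _ (hu k)).
Qed.

Lemma is_partial_dirac f x (d : 'I_3 -> Cl) :
  (forall j, is_partial j f x (d j)) -> dirac_op f x = \sum_j cl_gen R j * d j.
Proof. by move=> fd; apply: eq_bigr => j _; rewrite (is_partialE (fd j)). Qed.

Lemma dirac_partial N f j x : hpol N.+1 f ->
  dirac_op (partial j f) x = partial j (dirac_op f) x.
Proof.
move=> fN; apply/esym/is_partialE.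
rewrite /dirac_op; apply: is_partial_sum => l _; apply: is_partialMl.
by rewrite (partialC _ _ _ fN); exact/hpolP/hpol_partial/fN.
Qed.

Lemma dirac_opBMr M N f g c x : hpol M f -> hpol N g ->
  dirac_op (fun y => f y - g y * c) x = dirac_op f x - dirac_op g x * c.
Proof.
move=> fM gN.
rewrite (is_partial_dirac
  (fun j => is_partialB (hpolP j x fM) (is_partialMr c (hpolP j x gN)))).
rewrite (eq_bigr (fun j => cl_gen R j * partial j f x - cl_gen R j * partial j g x * c)).
  by rewrite sumrB -mulr_suml.
by move=> j _; rewrite mulrBr mulrA.
Qed.

(* Every partial derivative of [f] is again monogenic and vanishes on the
plane: the first two because they are tangential, the third because the Dirac
equation expresses it through the first two. *)
Lemma monogenic_plane_eq0 N f : hpol N f -> (forall x, dirac_op f x = 0) ->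
  (forall x, x 0 2 = 0 -> f x = 0) -> f = fun=> 0.
Proof.
elim: N f => [|N ih] f fN df f0.
  by move: fN f0 => [c ->] /(_ 0); rewrite mxE => /(_ erefl)->.
have tan j x : j != 2 -> x 0 2 = 0 -> partial j f x = 0.
  move=> j2 x2; apply/ffunP => A; rewrite !ffunE /derive.
  rewrite (_ : (fun h : R => _) = fun=> 0) ?lim_cst//; apply/funext => h /=.
  by rewrite !f0 ?subrr ?scaler0 ?ffunE// !mxE eqxx/= eq_sym (negbTE j2) mulr0 add0r.
suff p0 j : partial j f = fun=> 0.
  (* Euler's identity recovers [f] from its derivatives, since the degree [N.+1] is not zero. *)
  apply/funext => x; have := euler_hpol x fN.
  rewrite big1 => [/esym/eqP|j _]; last by rewrite p0 scaler0.
  by rewrite scaler_eq0 pnatr_eq0 => /eqP.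
apply: ih; first exact: hpol_partial.
  move=> x; rewrite (dirac_partial _ _ fN).
  by have -> : dirac_op f = fun=> 0 by [apply/funext]; apply/is_partialE/is_partial_cst.
move=> x x2; have [->|j2] := eqVneq j 2; last exact: tan.
have := df x; rewrite /dirac_op big_ord3 (tan 0)// (tan 1)// !mulr0 !add0r.
move=> /(congr1 (fun c => cl_gen R 2 * c)).
by rewrite /= mulr0 mulrA cl_gen_sqr mulN1r => /eqP; rewrite oppr_eq0 => /eqP.
Qed.

End HomogeneousPolynomials.

(** * The harmonic functions [psi] and their Dirac derivatives *)

Section HarmonicFamily.
Variable R : realType.
Local Notation E := 'rV[R]_3.
Local Notation Cl := (clifford R 3).
Implicit Types (f g : E -> Cl) (c d : Cl) (x : E).

Local Notation e1 := (cl_gen R (0 : 'I_3)).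
Local Notation e2 := (cl_gen R (1 : 'I_3)).
Local Notation e3 := (cl_gen R (2 : 'I_3)).
Local Notation J := (cl_gen R (0 : 'I_3) * cl_gen R (1 : 'I_3)).

Lemma sqrJ : J * J = -1.
Proof.
by rewrite mulrA -(mulrA e1) (@cl_gen_anticomm _ _ 1 0)// mulrN mulrA cl_gen_sqr
  mulN1r opprK cl_gen_sqr.
Qed.

Lemma e1J : e1 * J = - e2.
Proof. by rewrite mulrA cl_gen_sqr mulN1r. Qed.

Lemma Je1 : J * e1 = e2.
Proof.
by rewrite -mulrA (@cl_gen_anticomm _ _ 1 0)// mulrN mulrA cl_gen_sqr mulN1r opprK.
Qed.

Lemma e3J : e3 * J = J * e3.
Proof.
by rewrite mulrA (@cl_gen_anticomm _ _ 2 0)// mulNr -(mulrA e1 e3) (@cl_gen_anticomm _ _ 2 1)//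
  mulrN opprK mulrA.
Qed.

(** Twice the Wirtinger operators for the variable [wl 1], that is wbar = x_1 + x_2 J: [dbar] sends
    w to 2 and wbar to 0, and [dhol] does the reverse. *)
Definition dbar f x : Cl := partial 0 f x + J * partial 1 f x.
Definition dhol f x : Cl := partial 0 f x - J * partial 1 f x.

Lemma dirac_dhol f x : dirac_op f x = e1 * dhol f x + e3 * partial 2 f x.
Proof.
rewrite /dirac_op big_ord3 /dhol mulrBr; congr (_ + _ + _).
by rewrite [in RHS]mulrA e1J mulNr opprK.
Qed.

(** As e1 anticommutes with J, pulling it out of the operator turns [dhol] into [dbar]. In
    [dirac_e3] the operator [dhol] stays, because e3 commutes with J. *)
Lemma dirac_e1 N f x : hpol N f ->
  dirac_op (fun y => e1 * f y) x = - dbar f x + e3 * e1 * partial 2 f x.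
Proof.
move=> fN.
rewrite (is_partial_dirac (fun j => is_partialMl e1 (hpolP j x fN))).
rewrite big_ord3 !mulrA cl_gen_sqr mulN1r /dbar opprD; congr (_ + _ + _).
by rewrite (@cl_gen_anticomm _ _ 1 0)// mulNr.
Qed.

Lemma dirac_e3 N f x : hpol N f ->
  dirac_op (fun y => e3 * f y) x = - (e3 * e1 * dhol f x) - partial 2 f x.
Proof.
move=> fN.
rewrite (is_partial_dirac (fun j => is_partialMl e3 (hpolP j x fN))).
rewrite big_ord3 !mulrA cl_gen_sqr mulN1r /dhol mulrBr opprB.
congr (_ + _); rewrite addrC.
rewrite !mulrA -(mulrA e3 e1 e1) cl_gen_sqr mulrN1 (@cl_gen_anticomm _ _ 1 2)//.
by rewrite (@cl_gen_anticomm _ _ 0 2)// !mulNr.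
Qed.

(* Divided powers shifted by one, [dpow n.+1 c = c ^ n / n!] and [dpow 0 c = 0],
so that differentiation is [n |-> n.-1] for every [n]. *)
Definition dpow (n : nat) c : Cl := if n is n'.+1 then (n'`!%:R)^-1 *: c ^+ n' else 0.

Lemma comm_dpow c d n : GRing.comm c d -> GRing.comm c (dpow n d).
Proof.
case: n => [|n] cd; first exact: commr0.
by rewrite /GRing.comm -scalerAr -scalerAl (commrX n cd).
Qed.

(** Since [d] commutes with [f x], powers are differentiated as in a commutative ring, and the
    exponent cancels against the factorial. *)
Lemma is_partial_dpow j f x d n : is_partial j f x d -> GRing.comm d (f x) ->
  is_partial j (fun y => dpow n (f y)) x (d * dpow n.-1 (f x)).
Proof.
move=> fd dC; case: n => [|n] /=; first by rewrite mulr0; apply: is_partial_cst.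
have h : is_partial j (fun y => f y ^+ n) x (n%:R *: (d * f x ^+ n.-1)).
  elim: n => [|n ih]; first by rewrite scale0r; apply: is_partial_cst.
  under eq_fun do rewrite exprS.
  apply: is_partial_eq (is_partialM fd ih) _ => /=.
  rewrite mulrS scalerDl scale1r; congr (_ + _).
  case: (n) => [|m]; first by rewrite !scale0r mulr0.
  by rewrite -scalerAr mulrA -(dC : d * f x = f x * d) -mulrA -exprS.
apply: is_partial_eq (is_partialZ (n`!%:R)^-1 h) _.
case: (n) => [|m]; first by rewrite scale0r !scaler0 mulr0.
rewrite scalerA -scalerAr; congr (_ *: _).
by rewrite factS natrM invfM mulrAC mulVf ?mul1r// pnatr_eq0.
Qed.

Lemma hpol_dpow f n : hpol 1 f -> hpol n.-1 (fun x => dpow n (f x)).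
Proof.
by case: n => [|n] f1 /=; [exists 0|apply: hpolZ; have := hpolXn n f1; rewrite mul1n].
Qed.

(* [w] for [s = -1] and its conjugate for [s = 1]. *)
Definition wl (s : R) x : Cl := (x 0 0)%:A + (s * x 0 1) *: J.

Lemma hpol_wl s : hpol 1 (wl s).
Proof.
apply: hpolD; first exact: hpol_coord.
rewrite (_ : (fun x => _) = fun x => s *: ((x 0 1)%:A * J)).
  exact/hpolZ/hpolMr/hpol_coord.
by apply/funext => x; rewrite mulr_algl scalerA.
Qed.

Lemma is_partial_wl s j x :
  is_partial j (wl s) x ((0 == j)%:R%:A + (s * (1 == j)%:R) *: J).
Proof.
apply: is_partialD; first exact: is_partial_coord.
rewrite (_ : (fun x => _) = fun x => s *: ((x 0 1)%:A * J)); last first.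
  by apply/funext => y; rewrite mulr_algl scalerA.
rewrite -scalerA -[_ *: J]mulr_algl; apply/is_partialZ/is_partialMr.
exact: is_partial_coord.
Qed.

Lemma comm_alg t c : GRing.comm t%:A c.
Proof. by rewrite /GRing.comm mulr_algl mulr_algr. Qed.

Lemma commJ_wl s x : GRing.comm J (wl s x).
Proof.
apply: commrD; first exact/commr_sym/comm_alg.
by rewrite /GRing.comm -scalerAr -scalerAl.
Qed.

Lemma comm_wl s t x y : GRing.comm (wl s x) (wl t y).
Proof.
rewrite {1}/wl; apply/commr_sym/commrD; first exact/commr_sym/comm_alg.
by rewrite /GRing.comm -scalerAr -scalerAl commJ_wl.
Qed.

(** The product of divided powers of x_3, w and wbar with exponents a-1, p-1, q-1, which is zero
    once an index is 0; differentiation only lowers indices, without boundary cases. *)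
Definition tmon (a p q : nat) x : Cl :=
  dpow a (x 0 2)%:A * (dpow p (wl (-1) x) * dpow q (wl 1 x)).

Lemma tmon0l p q : tmon 0 p q = fun=> 0.
Proof. by apply/funext => x; rewrite /tmon mul0r. Qed.

Lemma tmon0m a q : tmon a 0 q = fun=> 0.
Proof. by apply/funext => x; rewrite /tmon mul0r mulr0. Qed.

Lemma tmon0r a p : tmon a p 0 = fun=> 0.
Proof. by apply/funext => x; rewrite /tmon !mulr0. Qed.

Lemma hpol_tmon a p q : hpol (a.-1 + (p.-1 + q.-1)) (tmon a p q).
Proof.
by do 2?apply: hpolM; apply: hpol_dpow; (exact: hpol_coord || exact: hpol_wl).
Qed.

Lemma is_partial_tmon j a p q x : is_partial j (tmon a p q) x
  ((2 == j)%:R *: tmon a.-1 p q x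
   + ((0 == j)%:R%:A - (1 == j)%:R *: J) * tmon a p.-1 q x
   + ((0 == j)%:R%:A + (1 == j)%:R *: J) * tmon a p q.-1 x).
Proof.
have h3 := is_partial_dpow a (is_partial_coord 2 j x) (comm_alg _ _).
have cw s : GRing.comm ((0 == j)%:R%:A + (s * (1 == j)%:R) *: J) (wl s x).
  apply/commr_sym/commrD; first exact/commr_sym/comm_alg.
  by rewrite /GRing.comm -scalerAr -scalerAl commJ_wl.
have hw s n := is_partial_dpow n (is_partial_wl s j x) (cw s).
apply: is_partial_eq (is_partialM h3 (is_partialM (hw _ _) (hw _ _))) _.
rewrite mulr_algl -scalerAl -addrA; congr (_ + _); rewrite mulrDr.
have c3 c : GRing.comm (dpow a (x 0 2)%:A) c.
  exact/commr_sym/comm_dpow/commr_sym/comm_alg.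
congr (_ + _).
  by rewrite mulN1r scaleNr -!mulrA mulrA (c3 (_ - _)) -!mulrA.
rewrite mul1r [dpow p _ * _]mulrA.
rewrite -(comm_dpow _ _ : _ * dpow p _ = dpow p _ * _); last first.
  apply/commr_sym/commrD; first exact/commr_sym/comm_alg.
  by rewrite /GRing.comm -scalerAr -scalerAl commJ_wl.
by rewrite -!mulrA mulrA c3 -!mulrA.
Qed.

Lemma partial2_tmon a p q x : is_partial 2 (tmon a p q) x (tmon a.-1 p q x).
Proof.
apply: is_partial_eq (is_partial_tmon _ _ _ _ _) _.
by rewrite eqxx/= !scale0r scale1r subrr addr0 !mul0r !addr0.
Qed.

Lemma partial0_tmon a p q x :
  is_partial 0 (tmon a p q) x (tmon a p.-1 q x + tmon a p q.-1 x).
Proof.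
apply: is_partial_eq (is_partial_tmon _ _ _ _ _) _.
by rewrite eqxx/= !scale0r scale1r subr0 addr0 !mul1r add0r.
Qed.

Lemma partial1_tmon a p q x :
  is_partial 1 (tmon a p q) x (J * (tmon a p q.-1 x - tmon a p.-1 q x)).
Proof.
apply: is_partial_eq (is_partial_tmon _ _ _ _ _) _.
by rewrite eqxx/= !scale0r scale1r sub0r !add0r mulrBr mulNr addrC.
Qed.

(* [L] is one plus the degree in [x_3], so that the derivatives of [psi] are
again of this form, with [psi 0 m = 0].  The terms with [L <= 2j] vanish because
the subtraction is truncated. *)
Definition psi (L m : nat) x : Cl :=
  \sum_(j < L) (- 4^-1) ^+ j *: tmon (L - j.*2) (j + m).+1 j.+1 x.

(** The terms with 2j >= L vanish, so the number of terms is flexible; this allows sums for [L],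
    [L.-1] and [L.-2] to be compared. *)
Lemma psi_widen K L m x : (L <= K.*2)%N ->
  \sum_(j < K) (- 4^-1) ^+ j *: tmon (L - j.*2) (j + m).+1 j.+1 x = psi L m x.
Proof.
pose F j := (- 4^-1) ^+ j *: tmon (L - j.*2) (j + m).+1 j.+1 x.
move=> LK; have F0 j : (L <= j.*2)%N -> F j = 0.
  by rewrite /F -subn_eq0 => /eqP->; rewrite tmon0l scaler0.
rewrite /psi -(big_mkord predT F) -(big_mkord predT F).
have aux a b : (a <= b)%N -> (L <= a.*2)%N -> \sum_(0 <= j < b) F j = \sum_(0 <= j < a) F j.
  move=> ab La; rewrite (@big_cat_nat _ _ _ a)//= [X in _ + X]big_nat_cond.
  rewrite [X in _ + X]big1 ?addr0// => j; rewrite andbT => /andP[aj _].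
  by apply: F0; rewrite (leq_trans La)// leq_double.
case/orP: (leq_total L K) => h; first by apply: aux => //; rewrite -addnn leq_addr.
by apply/esym/aux.
Qed.

Lemma psi0 m : psi 0 m = fun=> 0.
Proof. by apply/funext => x; rewrite /psi big_ord0. Qed.

Lemma hpol_psi L m : hpol (L + m).-1 (psi L m).
Proof.
apply: hpol_sum => j _; apply: hpolZ.
have [h|h] := leqP L j.*2.
  by rewrite (eqP (_ : L - j.*2 == 0)%N) ?subn_eq0// tmon0l; apply: hpol0.
have := hpol_tmon (L - j.*2) (j + m).+1 j.+1.
by rewrite (_ : (_ + _)%N = (L + m).-1)//; lia.
Qed.

Lemma is_partial_psi i L m x (d : nat -> Cl) :
  (forall j, is_partial i (tmon (L - j.*2) (j + m).+1 j.+1) x (d j)) ->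
  is_partial i (psi L m) x (\sum_(j < L) (- 4^-1) ^+ j *: d j).
Proof. by move=> h; apply: is_partial_sum => j _; apply: is_partialZ. Qed.

Lemma partial2_psi L m x : partial 2 (psi L m) x = psi L.-1 m x.
Proof.
rewrite (is_partialE (is_partial_psi (fun j => partial2_tmon _ _ _ x))).
rewrite -(@psi_widen L); last by rewrite -addnn; lia.
by apply: eq_bigr => j _; congr (_ *: tmon _ _ _ _); lia.
Qed.

(** The two halves of [dbar] agree on powers of w and cancel on powers of wbar, so only the exponent
    of w drops. *)
Lemma dbar_psi L m x : dbar (psi L m.+1) x = 2 *: psi L m x.
Proof.
rewrite /dbar (is_partialE (is_partial_psi (fun j => partial0_tmon _ _ _ x))).
rewrite (is_partialE (is_partial_psi (fun j => partial1_tmon _ _ _ x))).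
rewrite mulr_sumr scaler_sumr -big_split/=; apply: eq_bigr => j _.
rewrite -scalerAr mulrA sqrJ mulN1r opprB -scalerDr addrACA subrr addr0 addnS.
by rewrite scalerA mulrC -scalerA scaler_nat mulr2n.
Qed.

(** Now only the exponent of wbar drops: the term j = 0 disappears, and shifting j turns the factor
    2 into 2(-1/4). With [dbar_psi] and [partial2_psi] this makes [psi] harmonic, which is the
    purpose of the coefficient -1/4. *)
Lemma dhol_psi L m x : dhol (psi L m) x = (- 2^-1) *: psi L.-2 m.+1 x.
Proof.
rewrite /dhol (is_partialE (is_partial_psi (fun j => partial0_tmon _ _ _ x))).
rewrite (is_partialE (is_partial_psi (fun j => partial1_tmon _ _ _ x))).
rewrite mulr_sumr -sumrB.
have -> : \sum_(j < L) ((- 4^-1) ^+ j *: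
     (tmon (L - j.*2) (j + m) j.+1 x + tmon (L - j.*2) (j + m).+1 j x) -
     J * ((- 4^-1) ^+ j *: (J *
      (tmon (L - j.*2) (j + m).+1 j x - tmon (L - j.*2) (j + m) j.+1 x)))) =
   \sum_(j < L) (2 * (- 4^-1) ^+ j) *: tmon (L - j.*2) (j + m).+1 j x.
  apply: eq_bigr => j _.
  rewrite -scalerAr mulrA sqrJ mulN1r scalerN opprK -scalerDr.
  by rewrite addrC addrA subrK [2 * _]mulrC -scalerA scaler_nat mulr2n.
case: L => [|L]; first by rewrite psi0 scaler0 big_ord0.
rewrite big_ord_recl tmon0r scaler0 add0r -(@psi_widen L); last by rewrite -addnn/=; lia.
rewrite scaler_sumr; apply: eq_bigr => j _.
rewrite scalerA exprS mulrA; congr (_ * _ *: _); first by field.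
by rewrite lift0 addSnnS; congr (tmon _ _ _ _); lia.
Qed.

(** The Dirac derivative of [psi L.+1 m], by [dirac_psi]. For L = k-m and m < k it is F_(k-1)^m up
    to a real factor, by [basis_funE]. *)
Definition mono_fun (L m : nat) x : Cl :=
  e3 * psi L m x - 2^-1 *: (e1 * psi L.-1 m.+1 x).

Lemma dirac_psi L m x : dirac_op (psi L.+1 m) x = mono_fun L m x.
Proof.
rewrite dirac_dhol dhol_psi partial2_psi addrC; congr (_ + _).
by rewrite -scalerAr scaleNr.
Qed.

Lemma hpol_mono_fun L m : hpol (L + m).-1 (mono_fun L m).
Proof.
apply: hpolB; first exact/hpolMl/hpol_psi.
apply/hpolZ/hpolMl; case: L => [|L]; first by rewrite psi0; apply: hpol0.
by have := hpol_psi L m.+1; rewrite addnS.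
Qed.

Lemma dirac_mono_fun L m x : dirac_op (mono_fun L m) x = 0.
Proof.
have h1 := hpol_psi L m; have h2 := hpol_psi L.-1 m.+1.
pose g y := e3 * psi L m y; pose h y := e1 * psi L.-1 m.+1 y.
rewrite (is_partial_dirac (fun j => is_partialB (hpolP j x (hpolMl e3 h1))
  (is_partialZ 2^-1 (hpolP j x (hpolMl e1 h2))))).
under eq_bigr do rewrite mulrBr -scalerAr.
rewrite sumrB -scaler_sumr.
rewrite -[X in X - _]/(dirac_op g x) -[X in _ - _ *: X]/(dirac_op h x).
(* The two multiples of [psi L.-2 m.+1] cancel, and so do the two of [psi L.-1 m]. *)
rewrite (dirac_e3 _ h1) (dirac_e1 _ h2) dhol_psi dbar_psi !partial2_psi.
rewrite scalerDr scalerN scalerA mulVf ?pnatr_eq0// scale1r opprD opprK.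
rewrite -scalerAr scaleNr opprK addrACA [_ *: _ + _]addrC addrACA.
by rewrite !subrr addr0.
Qed.

End HarmonicFamily.

(** * Vanishing integrals over a period and over rectangles *)

Section RectangleIntegral.
Variable R : realType.
Local Notation mu := (@lebesgue_measure R).
Implicit Types (u v : R -> R) (a b : R).
Local Open Scope classical_set_scope.

Lemma continuous_segment_bound u a b : continuous u ->
  exists M, forall t, `[a, b] t -> `|u t| <= M.
Proof.
move=> cu; have : compact (u @` `[a, b]).
  by apply: continuous_compact; [exact: continuous_subspaceT|exact: segment_compact].
move=> /compact_bounded[M [_ /(_ (M + 1))]]; rewrite ltrDl ltr01 => /(_ isT) uM.
by exists (M + 1) => t tab; apply: uM; exists t.
Qed.

(** A bounded measurable function on a set of finite measure is integrable; the bounds come from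
    compactness of the two segments. *)
Lemma integrable_prod_rect u v a b c d : continuous u -> continuous v ->
  (mu \x mu)%E.-integrable (`[a, b] `*` `[c, d]) (EFin \o (fun p => u p.1 * v p.2)).
Proof.
move=> cu cv.
have mD : measurable (`[a, b] `*` `[c, d] : set (R * R)) by apply: measurableX.
apply: (@measurable_bounded_integrable _ _ _ (mu \x mu)%E (fun p => u p.1 * v p.2)
  (`[a, b] `*` `[c, d])); first exact: mD.
- rewrite [X in (X < _)%E](_ : _ = mu `[a, b] * mu `[c, d])%E; last exact: product_measure1E.
  rewrite !lebesgue_measure_itv/=.
  by do 2!case: ifP => _; rewrite ?mule0 ?mul0e ?ltry// -!EFinB -EFinM ltry.
- apply: (measurable_funS measurableT) => //; apply: measurable_funM.
    by apply: measurableT_comp; [exact: continuous_measurable_fun|exact: measurable_fst].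
  by apply: measurableT_comp; [exact: continuous_measurable_fun|exact: measurable_snd].
have [M uM] := continuous_segment_bound a b cu.
have [N vN] := continuous_segment_bound c d cv.
exists (M * N); split; first exact: num_real.
move=> K MNK [s t] [/= sab tcd]; rewrite normrM (le_trans _ (ltW MNK))//.
by apply: ler_pM => //; [exact: uM|exact: vN].
Qed.

Lemma Rintegral_prod_rect u v a b c d : continuous u -> continuous v ->
  \int[mu]_(t in `[a, b]) u t = 0 ->
  \int[(mu \x mu)%E]_(p in `[a, b] `*` `[c, d]) (u p.1 * v p.2) = 0.
Proof.
move=> cu cv u0; rewrite /Rintegral.
have mD : measurable (`[a, b] `*` `[c, d] : set (R * R)) by apply: measurableX.
have iu : mu.-integrable `[a, b] (EFin \o u).
  by apply: continuous_compact_integrable; [exact: segment_compact|exact: continuous_subspaceT].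
have := integrable_prod_rect a b c d cu cv; rewrite integrable_mkcond// => ifD.
(* Extended by zero to the whole plane, the integrand is subject to Fubini's theorem. The inner
   integral at [y] is [v y] times that of [u], or the integral of 0 when [y] is outside [[c, d]]. *)
rewrite integral_mkcond -(integral21_prod_meas1 ifD).
rewrite [X in fine X](_ : _ = 0%E)//; apply: integral0_eq => y _.
rewrite /fubini_G.
have [yD|yD] := boolP (y \in `[c, d]).
  transitivity (\int[mu]_(x in `[a, b]) ((v y)%:E * (u x)%:E))%E.
    rewrite [RHS]integral_mkcond; apply: eq_integral => x _.
    rewrite !patchE /= in_setX/= yD andbT.
    by case: ifP => // _; rewrite -EFinM mulrC.
  rewrite integralZl// -[X in (_ * X)%E]fineK; last exact: integrable_fin_num.
  by rewrite [fine _]u0 mule0.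
transitivity (\int[mu]_x (cst 0 x : \bar R))%E; last exact: integral0.
apply: eq_integral => x _; rewrite patchE in_setX/= (negbTE yD) andbF//.
Qed.

Lemma Rintegral_derive_eq0 (f F : R -> R) a b : a < b -> continuous f ->
  (forall t : R, is_derive t 1 F (f t)) -> F a = F b -> \int[mu]_(t in `[a, b]) f t = 0.
Proof.
move=> ab cf dF Fab; rewrite /Rintegral.
have cF : continuous F.
  by move=> t; apply/differentiable_continuous/derivable1_diffP; case: (dF t).
rewrite (@continuous_FTC2 _ _ F)//.
- by rewrite Fab -EFinB subrr.
- exact: continuous_subspaceT.
- split; first by move=> t _; case: (dF t).
    exact/cvg_at_right_filter/cF.
  exact/cvg_at_left_filter/cF.
- by move=> t _; rewrite derive1E; apply: derive_val.
Qed.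

Lemma sin_cos_nat2pi m : sin (m%:R * (2 * pi)) = 0 :> R /\ cos (m%:R * (2 * pi)) = 1 :> R.
Proof.
elim: m => [|m [ihs ihc]]; first by rewrite mul0r sin0 cos0.
by rewrite mulrS mulrDl mul1r addrC mulr_natl sinD2pi cosD2pi -mulr_natl ihs ihc.
Qed.

Lemma is_derive_mulr (m t : R) : is_derive t 1 (fun s : R => m * s) m.
Proof. by have := is_deriveZ m (is_derive_id t 1); rewrite [m *: 1]mulr1. Qed.

Lemma continuous_cos_nat m : continuous (fun t : R => cos (m%:R * t)).
Proof.
by move=> t; apply: continuous_comp; [exact: mulrl_continuous|exact: continuous_cos].
Qed.

Lemma continuous_sin_nat m : continuous (fun t : R => sin (m%:R * t)).
Proof.
by move=> t; apply: continuous_comp; [exact: mulrl_continuous|exact: continuous_sin].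
Qed.

Lemma Rintegral_cos_period m : (0 < m)%N ->
  \int[mu]_(t in `[0, 2 * pi]) cos (m%:R * t) = 0.
Proof.
move=> m0; have mn0 : m%:R != 0 :> R by rewrite pnatr_eq0 -lt0n.
apply: (@Rintegral_derive_eq0 _ (fun t => m%:R^-1 * sin (m%:R * t))).
- by rewrite mulr_gt0// pi_gt0.
- exact: continuous_cos_nat.
- move=> t; have := is_deriveZ (m%:R^-1) (is_derive1_comp
    (is_derive_sin (m%:R * t)) (is_derive_mulr m%:R t)).
  by move/is_derive_eq; apply; rewrite /GRing.scale/= mulrC mulfK.
- by rewrite (sin_cos_nat2pi m).1 mulr0 sin0.
Qed.

Lemma Rintegral_sin_period m : (0 < m)%N ->
  \int[mu]_(t in `[0, 2 * pi]) sin (m%:R * t) = 0.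
Proof.
move=> m0; have mn0 : m%:R != 0 :> R by rewrite pnatr_eq0 -lt0n.
apply: (@Rintegral_derive_eq0 _ (fun t => (- m%:R^-1) * cos (m%:R * t))).
- by rewrite mulr_gt0// pi_gt0.
- exact: continuous_sin_nat.
- move=> t; have := is_deriveZ (- m%:R^-1) (is_derive1_comp
    (is_derive_cos (m%:R * t)) (is_derive_mulr m%:R t)).
  by move/is_derive_eq; apply; rewrite /GRing.scale/= !mulNr mulrN opprK mulrC mulfK.
- by rewrite (sin_cos_nat2pi m).2 mulr0 cos0.
Qed.

End RectangleIntegral.

(** * Rotors and the functions [psi] in spherical coordinates *)

Section Rotors.
Variable R : realType.
Local Notation Cl := (clifford R 3).
Local Notation e1 := (cl_gen R (0 : 'I_3)).
Local Notation e3 := (cl_gen R (2 : 'I_3)).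
Local Notation J := (cl_gen R (0 : 'I_3) * cl_gen R (1 : 'I_3)).

(** The exponential of tJ, as J squares to -1. *)
Definition rotor (t : R) : Cl := (cos t)%:A + sin t *: J.

Lemma rotor0 : rotor 0 = 1.
Proof. by rewrite /rotor cos0 sin0 !scale0r addr0 scale1r. Qed.

Lemma rotorD s t : rotor (s + t) = rotor s * rotor t.
Proof.
rewrite /rotor mulrDl !mulrDr !mulr_algl !mulr_algr -!scalerAl -scalerAr sqrJ.
rewrite !scalerA scalerN cosD sinD scalerBl scalerDl addrACA [RHS]addrACA.
by rewrite [- _ + _]addrC [cos t * _]mulrC.
Qed.

Lemma rotorX t n : rotor t ^+ n = rotor (n%:R * t).
Proof.
elim: n => [|n ih]; first by rewrite mul0r rotor0.
by rewrite exprS ih -rotorD mulrS mulrDl mul1r.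
Qed.

Lemma rotor_conj t : cl_conj (rotor t) = rotor (- t).
Proof.
rewrite /rotor linearD !linearZ/= cl_conj1 cl_conjM !cl_conj_gen mulrNN cosN sinN.
by rewrite (@cl_gen_anticomm _ _ 1 0)// scalerN scaleNr.
Qed.

Lemma rotor_e3 t : rotor t * e3 = e3 * rotor t.
Proof. by rewrite mulrDl mulrDr mulr_algl mulr_algr -scalerAl -scalerAr e3J. Qed.

(** The angle is reversed because e1 anticommutes with J. *)
Lemma rotor_e1 t : rotor t * e1 = e1 * rotor (- t).
Proof.
rewrite mulrDl mulrDr mulr_algl mulr_algr -scalerAl -scalerAr Je1 e1J cosN sinN.
by rewrite scaleNr scalerN opprK.
Qed.

Lemma wl_spherical (s r theta phi : R) : s = 1 \/ s = -1 ->
  wl s (spherical r theta phi) = (r * sin phi) *: rotor (s * theta).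
Proof.
move=> s1; rewrite /wl /rotor !mxE /= scalerDr !scalerA.
by case: s1 => ->; rewrite ?mul1r ?mulN1r ?cosN ?sinN; congr (_ *: _ + _ *: _); ring.
Qed.

Lemma tmon_spherical a p q r theta phi :
  tmon a.+1 p.+1 q.+1 (spherical r theta phi) =
  ((a`!%:R * p`!%:R * q`!%:R)^-1 * (r * cos phi) ^+ a * (r * sin phi) ^+ (p + q))
    *: rotor ((q%:R - p%:R) * theta).
Proof.
rewrite /tmon /= !wl_spherical; [|by left|by right].
have pw c t n : (c *: rotor t) ^+ n = c ^+ n *: rotor (n%:R * t) by rewrite exprZn rotorX.
have algX c n : (c%:A : Cl) ^+ n = (c ^+ n)%:A by rewrite exprZn expr1n.
rewrite !mxE/= !pw algX -!(@scalerAl _ Cl) -!(@scalerAr _ Cl) !mul1r -rotorD !scalerA.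
congr (_ *: rotor _); last by ring.
by rewrite !invfM exprD; ring.
Qed.

Lemma continuous_bigsum (I : Type) (r : seq I) (F : I -> R -> R) :
  (forall i, continuous (F i)) -> continuous (fun t => \sum_(i <- r) F i t).
Proof.
move=> cF; elim: r => [|i r ih] t.
  by under eq_fun do rewrite big_nil; exact: cvg_cst.
by under eq_fun do rewrite big_cons; apply: cvgD; [exact: cF|exact: ih].
Qed.

(** Every term of [psi] has m more factors w than wbar, so all terms share one rotor. *)
Lemma psi_spherical L m : exists2 V : R -> R, continuous V &
  forall theta phi, psi L m (spherical 1 theta phi) = V phi *: rotor (- (m%:R * theta)).
Proof.
(* The match follows the truncated subtraction: the term of [psi] is 0 once 2j >= L. *)
pose v j phi : R := if (L - j.*2)%N is a.+1 then
   (- 4^-1) ^+ j * ((a`!%:R * (j + m)`!%:R * j`!%:R)^-1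
   * cos phi ^+ a * sin phi ^+ (j + m + j)) else 0.
exists (fun phi => \sum_(j < L) v j phi).
  apply: continuous_bigsum => j phi; rewrite /v.
  case: (L - j.*2)%N => [|a]; first exact: cvg_cst.
  apply: cvgM; first exact: cvg_cst.
  apply: cvgM; last first.
    apply: (@continuous_comp _ _ _ sin (fun x : R => x ^+ _)).
      exact: continuous_sin.
    exact: exprn_continuous.
  apply: cvgM; first exact: cvg_cst.
  apply: (@continuous_comp _ _ _ cos (fun x : R => x ^+ _)).
    exact: continuous_cos.
  exact: exprn_continuous.
move=> theta phi; rewrite /psi scaler_suml; apply: eq_bigr => j _; rewrite /v.
case: (L - j.*2)%N => [|a]; first by rewrite tmon0l scaler0 scale0r.
rewrite tmon_spherical !mul1r scalerA; congr (_ *: rotor _).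
by rewrite natrD; ring.
Qed.

End Rotors.

(** * Orthogonality on the sphere *)

Section Orthogonality.
Variable R : realType.
Local Notation Cl := (clifford R 3).
Local Notation mu := (@lebesgue_measure R).
Local Notation e1 := (cl_gen R (0 : 'I_3)).
Local Notation e2 := (cl_gen R (1 : 'I_3)).
Local Notation e3 := (cl_gen R (2 : 'I_3)).
Local Notation D := (`[0, 2 * pi] `*` `[0, pi])%classic.
Implicit Types (g h : R * R -> R) (G H : R * R -> Cl).

(** Integrability is carried along because additivity of the integral asks for it. *)
Definition null_integral g : Prop :=
  (mu \x mu)%E.-integrable D (EFin \o g) /\ \int[(mu \x mu)%E]_(p in D) g p = 0.

Let mD : measurable (D : set (measurableTypeR R * measurableTypeR R)%type).
Proof. exact: measurableX. Qed.

Lemma null_integralD g h : null_integral g -> null_integral h ->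
  null_integral (fun p => g p + h p).
Proof.
move=> [ig g0] [ih h0]; split; first exact: (integrableD mD ig ih).
by rewrite (RintegralD mD ig ih) g0 h0 addr0.
Qed.

Lemma null_integralZ c g : null_integral g -> null_integral (fun p => c * g p).
Proof.
move=> [ig g0]; split; first exact: (integrableZl mD c ig).
by rewrite (RintegralZl c mD ig) g0 mulr0.
Qed.

Lemma null_integral0 : null_integral (fun=> 0).
Proof.
by split; [exact: integrable0|rewrite Rintegral_cst// mul0r].
Qed.

Lemma null_integral_sum (I : Type) (r : seq I) (F : I -> R * R -> R) :
  (forall i, null_integral (F i)) -> null_integral (fun p => \sum_(i <- r) F i p).
Proof.
move=> F0; elim: r => [|i r ih].
  by under eq_fun do rewrite big_nil; exact: null_integral0.
by under eq_fun do rewrite big_cons; exact: null_integralD.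
Qed.

Lemma null_integral_prod (u v : R -> R) : continuous u -> continuous v ->
  \int[mu]_(t in `[0, 2 * pi]%classic) u t = 0 ->
  null_integral (fun p => u p.1 * v p.2).
Proof.
by move=> cu cv u0; split; [exact: integrable_prod_rect|exact: Rintegral_prod_rect].
Qed.

Definition sphere_null G : Prop := forall A, null_integral (fun p => G p A * sin p.2).

Lemma sphere_nullD G H : sphere_null G -> sphere_null H ->
  sphere_null (fun p => G p + H p).
Proof.
move=> G0 H0 A; under eq_fun do rewrite cl_addE mulrDl.
exact: null_integralD.
Qed.

Lemma sphere_nullMl c G : sphere_null G -> sphere_null (fun p => c * G p).
Proof.
move=> G0 A; under eq_fun do rewrite cl_mulE mulr_suml.
apply: null_integral_sum => B; under eq_fun do rewrite mulr_suml.
apply: null_integral_sum => C; rewrite (_ : (fun p => _) = fun p =>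
  ((-1) ^+ cl_sign B C * (A == symdiff B C)%:R * c B) * (G p C * sin p.2)).
  exact: null_integralZ (G0 C).
by apply/funext => p; ring.
Qed.

Lemma sphere_null_rotor (V : R -> R) m z : continuous V -> (0 < m)%N ->
  z = m%:R \/ z = - m%:R -> sphere_null (fun p => V p.2 *: rotor (z * p.1)).
Proof.
move=> cV m0 zm A; pose W t := V t * sin t.
have cW : continuous W.
  by move=> t; apply: cvgM; [exact: cV|exact: continuous_sin].
(* The sign of [z], which comes out of the sine. *)
pose e := if z == m%:R then 1 else -1 : R.
rewrite (_ : (fun p => _) = fun p => (1 : Cl) A * (cos (m%:R * p.1) * W p.2)
    + (e * (e1 * e2) A) * (sin (m%:R * p.1) * W p.2)).
  apply: null_integralD; apply: null_integralZ.
    by apply: (@null_integral_prod (fun t => cos (m%:R * t)) W);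
      [exact: continuous_cos_nat|exact: cW|exact: Rintegral_cos_period].
  by apply: (@null_integral_prod (fun t => sin (m%:R * t)) W);
    [exact: continuous_sin_nat|exact: cW|exact: Rintegral_sin_period].
apply/funext => p; rewrite cl_scaleE cl_addE !cl_scaleE /W /e.
case: eqP zm => [->|/eqP znm] []; first by move=> _; ring.
- by move=> _; ring.
- by move=> zm; rewrite zm eqxx in znm.
- by move=> ->; rewrite mulNr cosN sinN; ring.
Qed.

(** The products with e3 twice or e1 twice both have frequency n-n', nonzero by hypothesis. In the
    mixed products e1 reverses an angle, so the frequencies add up to -(n+n'+1), which is never
    zero. *)
Lemma sphere_null_mono_fun L L' n n' : n != n' ->
  sphere_null (fun p => cl_conj (mono_fun L n (spherical 1 p.1 p.2))
                        * mono_fun L' n' (spherical 1 p.1 p.2)).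
Proof.
move=> nn'; rewrite /mono_fun.
have [V0 cV0 hV0] := psi_spherical R L n.
have [V1 cV1 hV1] := psi_spherical R L.-1 n.+1.
have [W0 cW0 hW0] := psi_spherical R L' n'.
have [W1 cW1 hW1] := psi_spherical R L'.-1 n'.+1.
pose z : R := n%:R - n'%:R; pose y : R := - (n + n').+1%:R.
rewrite (_ : (fun p => _) = fun p =>
   (V0 p.2 * W0 p.2 + 4^-1 * (V1 p.2 * W1 p.2)) *: rotor (z * p.1)
  + e3 * e1 * ((2^-1 * (V0 p.2 * W1 p.2 - V1 p.2 * W0 p.2)) *: rotor (y * p.1))).
  have cM (f g : R -> R) : continuous f -> continuous g -> continuous (fun t => f t * g t).
    by move=> cf cg t; apply: cvgM; [exact: cf|exact: cg].
  have cZ c (f : R -> R) : continuous f -> continuous (fun t => c * f t).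
    by move=> cf t; apply: cvgM; [exact: cvg_cst|exact: cf].
  apply: sphere_nullD; last apply: sphere_nullMl.
    apply: (@sphere_null_rotor (fun t => V0 t * W0 t + 4^-1 * (V1 t * W1 t)) `|n - n'|).
    - by move=> t; apply: cvgD; [exact: (cM V0 W0)|exact: (cZ _ _ (cM _ _ cV1 cW1))].
    - by rewrite lt0n distn_eq0.
    - rewrite /z; case: (leqP n' n) => h; [left|right].
        by rewrite distnEl// natrB.
      by rewrite distnEr ?natrB ?opprB// ltnW.
  apply: (@sphere_null_rotor (fun t => 2^-1 * (V0 t * W1 t - V1 t * W0 t)) (n + n').+1) => //.
    by apply: cZ => t; apply: cvgB; [exact: (cM V0 W1)|exact: (cM V1 W0)].
  by right.
apply/funext => -[t u]/=.
have conjB (a b : Cl) k : cl_conj (a - k *: b) = cl_conj a - k *: cl_conj b.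
  by rewrite linearB linearZ.
have conjZ (a : Cl) k : cl_conj (k *: a) = k *: cl_conj a by rewrite linearZ.
rewrite hV0 hV1 hW0 hW1 conjB !cl_conjM !cl_conj_gen !conjZ !rotor_conj !opprK.
have e33 a b : rotor a * - e3 * (e3 * rotor b) = rotor (a + b).
  by rewrite mulrN mulNr -mulrA (mulrA e3 e3) cl_gen_sqr mulN1r mulrN opprK rotorD.
have e11 a b : rotor a * - e1 * (e1 * rotor b) = rotor (a + b).
  by rewrite mulrN mulNr -mulrA (mulrA e1 e1) cl_gen_sqr mulN1r mulrN opprK rotorD.
have e31 a b : rotor a * - e3 * (e1 * rotor b) = - (e3 * e1 * rotor (b - a)).
  rewrite mulrN mulNr -mulrA mulrA rotor_e3 -!mulrA (mulrA (rotor a)) rotor_e1.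
  by rewrite -(mulrA e1) -rotorD [- a + b]addrC.
have e13 a b : rotor a * - e1 * (e3 * rotor b) = e3 * e1 * rotor (b - a).
  rewrite mulrN mulNr rotor_e1 !mulrA -(mulrA e1) rotor_e3 mulrA -(mulrA (e1 * e3)) -rotorD.
  by rewrite (@cl_gen_anticomm _ _ 0 2)// mulNr opprK [- a + b]addrC.
rewrite -!(@scalerAr _ Cl) -!(@scalerAl _ Cl) mulrBl !mulrBr.
rewrite -!(@scalerAr _ Cl) -!(@scalerAl _ Cl).
rewrite e33 e31 e13 e11.
have -> : n%:R * t - n'%:R * t = z * t by rewrite /z; ring.
have -> : n.+1%:R * t - n'.+1%:R * t = z * t by rewrite /z; ring.
have -> : - (n'.+1%:R * t) - n%:R * t = y * t by rewrite /y -addSn natrD; ring.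
have -> : - (n'%:R * t) - n.+1%:R * t = y * t by rewrite /y -addSn natrD; ring.
move: (rotor (z * t)) (_ * rotor (y * t)) => X Y.
by apply/ffunP => A; rewrite !(cl_addE, cl_scaleE, ffunE); field.
Qed.

End Orthogonality.

(** * Restriction to the plane x_3 = 0 and the basis criterion *)

Section PlaneRestriction.
Variable R : realType.
Local Notation E := 'rV[R]_3.
Local Notation Cl := (clifford R 3).
Local Notation e1 := (cl_gen R (0 : 'I_3)).
Local Notation e3 := (cl_gen R (2 : 'I_3)).
Local Notation J := (cl_gen R (0 : 'I_3) * cl_gen R (1 : 'I_3)).
Implicit Types (f g : E -> Cl) (c : nat -> Cl) (x : E).

(** The first index 1 means exponent 0 for x_3, so this is the divided monomial in w and wbar with
    exponents b and N-b. *)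
Local Notation planar N b := (tmon (R := R) 1 b.+1 (N - b).+1).

Lemma tmonC a p q x : tmon (R := R) a p q x =
  dpow a (x 0 2)%:A * (dpow q (wl 1 x) * dpow p (wl (-1) x)).
Proof.
rewrite /tmon; congr (_ * _).
exact/comm_dpow/commr_sym/comm_dpow/comm_wl.
Qed.

Lemma wlMdpow s p x : wl s x * dpow p.+1 (wl s x) = p.+1%:R *: dpow p.+2 (wl s x).
Proof.
rewrite /= -scalerAr -exprS scalerA; congr (_ *: _).
by rewrite factS natrM invfM mulrA mulfV ?mul1r// pnatr_eq0.
Qed.

Lemma wlMtmon_l a p q x :
  wl (-1) x * tmon a p.+1 q x = p.+1%:R *: tmon a p.+2 q x.
Proof.
rewrite /tmon mulrA (comm_dpow a (commr_sym (comm_alg _ _))) .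
by rewrite -mulrA [wl _ _ * _]mulrA wlMdpow -scalerAl -scalerAr.
Qed.

Lemma wlMtmon_r a p q x :
  wl 1 x * tmon a p q.+1 x = q.+1%:R *: tmon a p q.+2 x.
Proof.
rewrite !tmonC mulrA (comm_dpow a (commr_sym (comm_alg _ _))).
by rewrite -mulrA [wl _ _ * _]mulrA wlMdpow -scalerAl -scalerAr.
Qed.

Lemma tmon1E p q x : tmon (R := R) 1 p q x = dpow p (wl (-1) x) * dpow q (wl 1 x).
Proof. by rewrite /tmon /= expr0 fact0 invr1 scale1r mul1r. Qed.

Lemma JMtmon p q x : J * tmon 1 p q x = tmon 1 p q x * J.
Proof.
rewrite !tmon1E; apply: commrM; apply: comm_dpow; exact: commJ_wl.
Qed.

Lemma e3Mtmon p q x : e3 * tmon 1 p q x = tmon 1 p q x * e3.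
Proof.
have h s : GRing.comm e3 (wl s x).
  apply: commrD; first exact/commr_sym/comm_alg.
  by rewrite /GRing.comm -scalerAr -scalerAl e3J.
by rewrite !tmon1E; apply: commrM; apply: comm_dpow.
Qed.

(** As e1 anticommutes with J, moving it across exchanges w and wbar. *)
Lemma e1Mtmon p q x : e1 * tmon 1 p q x = tmon 1 q p x * e1.
Proof.
have h s n : e1 * dpow n (wl s x) = dpow n (wl (- s) x) * e1.
  case: n => [|n]; first by rewrite mulr0 mul0r.
  rewrite /= -scalerAr -scalerAl; congr (_ *: _).
  elim: n => [|n ih]; first by rewrite mulr1 mul1r.
  rewrite !exprS mulrA -[RHS]mulrA -ih mulrA; congr (_ * _).
  rewrite mulrDl mulrDr mulr_algl mulr_algr -scalerAl -scalerAr Je1 e1J.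
  by rewrite mulNr scaleNr scalerN.
rewrite !tmon1E mulrA h opprK -mulrA h mulrA; congr (_ * _).
exact/comm_dpow/commr_sym/comm_dpow/comm_wl.
Qed.

(** Coefficients are indexed by [nat] so that they can be shifted when the degree grows. *)
Definition planar_span N f : Prop := exists c, forall x, x 0 2 = 0 ->
  f x = \sum_(b < N.+1) planar N b x * c b.

Lemma planar_spanD N f g : planar_span N f -> planar_span N g ->
  planar_span N (fun x => f x + g x).
Proof.
move=> [c fc] [d gd]; exists (fun b => c b + d b) => x x0.
by rewrite fc// gd// -big_split; apply: eq_bigr => b _; rewrite mulrDr.
Qed.

Lemma planar_spanZ N t f : planar_span N f -> planar_span N (fun x => t *: f x).
Proof.
move=> [c fc]; exists (fun b => t *: c b) => x x0.
by rewrite fc// scaler_sumr; apply: eq_bigr => b _; rewrite scalerAr.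
Qed.

Lemma planar_spanJ N f : planar_span N f -> planar_span N (fun x => J * f x).
Proof.
move=> [c fc]; exists (fun b => J * c b) => x x0.
by rewrite fc// mulr_sumr; apply: eq_bigr => b _; rewrite mulrA JMtmon -mulrA.
Qed.

Lemma planar_span_wl_l N f : planar_span N f ->
  planar_span N.+1 (fun x => wl (-1) x * f x).
Proof.
(* In divided powers, multiplication by w raises b and brings the new exponent as a factor; this
   factor also removes the spurious term at b = 0. *)
move=> [c fc]; exists (fun b => b%:R *: c b.-1) => x x0.
rewrite fc// [RHS]big_ord_recl scale0r mulr0 add0r mulr_sumr; apply: eq_bigr => b _.
by rewrite mulrA wlMtmon_l lift0 subSS -scalerAl -scalerAr.
Qed.

Lemma planar_span_wl_r N f : planar_span N f ->
  planar_span N.+1 (fun x => wl 1 x * f x).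
Proof.
move=> [c fc]; exists (fun b => (N.+1 - b)%:R *: c b) => x x0.
rewrite fc// [RHS]big_ord_recr/= subnn scale0r mulr0 addr0 mulr_sumr; apply: eq_bigr => b _.
by rewrite mulrA wlMtmon_r (subSn (leq_ord b)) -scalerAl -scalerAr.
Qed.

(** On the plane x_1 = (w + wbar)/2 and x_2 = J(w - wbar)/2, so multiplication by a coordinate takes
    the span of degree N to that of degree N+1. *)
Lemma hpol_planar_span N f : hpol N f -> planar_span N f.
Proof.
elim: N f => [|N ih] f.
  move=> [d ->]; exists (fun=> d) => x x0.
  by rewrite big_ord1 tmon1E /= !expr0 fact0 invr1 !scale1r !mul1r.
move=> [u hu ->].
have [/ih u0 /ih u1] := (hu 0, hu 1).
have [c hc] : planar_span N.+1 (fun x =>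
    2^-1 *: (wl (-1) x * u 0 x + wl 1 x * u 0 x)
    + 2^-1 *: (J * (wl (-1) x * u 1 x + (-1) *: (wl 1 x * u 1 x)))).
  apply: planar_spanD; apply: planar_spanZ.
    by apply: planar_spanD; [exact: planar_span_wl_l|exact: planar_span_wl_r].
  apply/planar_spanJ/planar_spanD; first exact: planar_span_wl_l.
  exact/planar_spanZ/planar_span_wl_r.
exists c => x x2; rewrite -hc// big_ord3 x2 scale0r addr0.
have wlD : wl (-1) x + wl 1 x = (2 * x 0 0)%:A.
  by apply/ffunP => A; rewrite !(cl_addE, cl_scaleE); ring.
have wlB : wl (-1) x - wl 1 x = (- 2 * x 0 1) *: J.
  by apply/ffunP => A; rewrite /wl !(cl_addE, cl_scaleE, ffunE); ring.
rewrite -mulrDl wlD mulr_algl scalerA mulKf ?pnatr_eq0//; congr (_ + _).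
rewrite scaleN1r -mulrBl wlB mulrA -scalerAr sqrJ scalerN -scaleNr mulr_algl scalerA.
by rewrite mulNr opprK mulKf ?pnatr_eq0.
Qed.

Lemma tmon1_proj p q x (y : E) : x 0 0 = y 0 0 -> x 0 1 = y 0 1 ->
  tmon (R := R) 1 p q x = tmon 1 p q y.
Proof. by move=> h0 h1; rewrite !tmon1E /wl h0 h1. Qed.

(** Applying [dbar] lowers b and the degree by one, so induction kills every coefficient except
    [c 0], which is then read off at the point (1,0,0). *)
Lemma planar_free N c : (forall x, \sum_(b < N.+1) planar N b x * c b = 0) ->
  forall b, (b <= N)%N -> c b = 0.
Proof.
elim: N c => [|N ih] c c0.
  case=> // _; have := c0 0; rewrite big_ord1 tmon1E /= !expr0 fact0 invr1 !scale1r.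
  by rewrite !mul1r.
have cS b : (b <= N)%N -> c b.+1 = 0.
  apply: (ih (fun b => c b.+1)) => x.
  pose f y := \sum_(b < N.+2) planar N.+1 b y * c b.
  have f0 : f = fun=> 0 by apply/funext.
  have p0 : is_partial 0 f x (\sum_(b < N.+2)
      (tmon 1 b (N.+1 - b).+1 x + tmon 1 b.+1 (N.+1 - b) x) * c b).
    by apply: is_partial_sum => j _; apply/is_partialMr/partial0_tmon.
  have p1 : is_partial 1 f x (\sum_(b < N.+2)
      J * (tmon 1 b.+1 (N.+1 - b) x - tmon 1 b (N.+1 - b).+1 x) * c b).
    by apply: is_partial_sum => j _; apply/is_partialMr/partial1_tmon.
  have : partial 0 f x + J * partial 1 f x = 0.
    by rewrite f0 !(is_partialE (is_partial_cst _ _ _)) mulr0 addr0.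
  rewrite (is_partialE p0) (is_partialE p1) mulr_sumr -big_split/=.
  rewrite (eq_bigr (fun b : 'I_N.+2 => 2 *: (tmon 1 b (N.+1 - b).+1 x * c b))).
    rewrite -scaler_sumr big_ord_recl tmon0m mul0r add0r => /eqP.
    rewrite scaler_eq0 pnatr_eq0 => /eqP h; rewrite -[RHS]h.
    by apply: eq_bigr => j _; rewrite lift0 subSS.
  move=> j _; rewrite (mulrA J (_ * _)) (mulrA J J) sqrJ mulN1r mulNr -mulrBl opprB.
  by rewrite addrACA subrr addr0 -mulr2n -scaler_nat -scalerAl.
have := c0 (delta_mx 0 0).
rewrite big_ord_recl big1 => [|j _]; last by rewrite lift0 cS ?mulr0// -ltnS.
rewrite addr0 subn0 tmon1E /wl !mxE/= !mulr0 !scale0r !addr0 !scale1r !expr1n.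
rewrite fact0 invr1 scale1r mul1r mulr_algl => /eqP.
rewrite scaler_eq0 invr_eq0 pnatr_eq0 eqn0Ngt fact_gt0/= => /eqP c00.
by case.
Qed.


(** Both halves are decided on the plane: two monogenic polynomials that agree there are equal, and
    a relation among the [F n] restricts to one among planar monomials. *)
Lemma right_basis_of_plane N (F : 'I_N.+1 -> E -> Cl) (s : 'I_N.+1 -> 'I_N.+1)
    (u v : 'I_N.+1 -> Cl) :
  injective s -> (forall n, inner_monogenic R N (F n)) ->
  (forall n, u n * v n = 1) -> (forall n, v n * u n = 1) ->
  (forall n x, x 0 2 = 0 -> F n x = planar N (s n) x * u n) ->
  right_basis (inner_monogenic R N) F.
Proof.
move=> s_inj FM uv vu Fp; split=> // [f [fN df]|a Fa0 n].
  move/hpol_poly in fN; have [c fc] := hpol_planar_span fN.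
  (* The factor [v n] undoes the unit [u n], so the combination agrees with [f] on the plane. *)
  pose a n := v n * c (s n); exists a => x.
  have FN n : hpol N (F n) by apply/hpol_poly; case: (FM n).
  pose g y := f y - \sum_n F n y * a n.
  have gN : hpol N g.
    by apply: hpolB => //; apply: hpol_sum => n _; apply: hpolMr.
  suff : g = fun=> 0 by move=> /(congr1 (fun h => h x))/eqP; rewrite subr_eq0 => /eqP.
  apply: (monogenic_plane_eq0 gN) => y.
    have p j : is_partial j g y (partial j f y - \sum_n partial j (F n) y * a n).
      apply: is_partialB; first exact: hpolP fN.
      by apply: is_partial_sum => n _; apply/is_partialMr/(hpolP _ _ (FN n)).
    rewrite (is_partial_dirac p).
    rewrite (eq_bigr (fun j => cl_gen R j * partial j f y
        - \sum_n cl_gen R j * partial j (F n) y * a n)); last first.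
      move=> j _; rewrite mulrBr; congr (_ - _); rewrite [LHS]mulr_sumr.
      by apply: eq_bigr => n _; rewrite mulrA.
    rewrite sumrB [X in _ - X]exchange_big/= -[X in X - _]/(dirac_op f y) df.
    rewrite sub0r big1 ?oppr0// => n _.
    by rewrite -mulr_suml -[X in X * _]/(dirac_op (F n) y) (FM n).2 mul0r.
  move=> y2; rewrite /g fc// (reindex_inj s_inj)/=; apply/eqP; rewrite subr_eq0.
  by apply/eqP/eq_bigr => n _; rewrite Fp// /a -mulrA (mulrA (u n)) uv mul1r.
have [t st ts] := injF_bij s_inj.
pose c b := u (t (inord b)) * a (t (inord b)).
have c0 : forall b, (b <= N)%N -> c b = 0.
  apply: planar_free => x.
  (* [F n] is described on the plane only, so [x] is projected there; planar monomials do not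
     involve x_3. *)
  pose y : E := \row_j (if j == 2 then 0 else x 0 j).
  rewrite -[RHS](Fa0 y) (reindex_inj s_inj)/=; apply: eq_bigr => n' _.
  rewrite Fp ?mxE// -mulrA (@tmon1_proj _ _ x y) ?mxE//; congr (_ * _).
  by rewrite /c inord_val st.
have := c0 (s n) (leq_ord _); rewrite /c inord_val st.
by move=> /(congr1 ( *%R (v n))); rewrite mulr0 mulrA vu mul1r.
Qed.

(* Of the two terms of [mono_fun], exactly one survives on the plane, according
to the parity of [k - n]. *)
Definition sigma k n : nat :=
  if odd (k - n) then ((k - n)./2 + n)%N else (k - n)./2.-1.

Lemma sigma_lt k n : (n < k)%N -> (sigma k n < k)%N.
Proof. by rewrite /sigma; case: ifP; lia. Qed.

Lemma sigma_inj k n n' : (n < k)%N -> (n' < k)%N -> sigma k n = sigma k n' -> n = n'.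
Proof. by rewrite /sigma; do 2!case: ifP; lia. Qed.

(** A term survives only when its exponent of x_3 is 0, that is L-2j = 1, which forces L to be
    odd. *)
Lemma psi_plane L m x : x 0 2 = 0 -> psi L m x =
  if odd L then (- 4^-1) ^+ L./2 *: tmon 1 (L./2 + m).+1 L./2.+1 x else 0.
Proof.
move=> x2.
have t0 a p q : a != 1%N -> tmon (R := R) a p q x = 0.
  case: a => [|[|a]]// _; first by rewrite tmon0l.
  by rewrite /tmon x2 /= scale0r expr0n/= scaler0 mul0r.
rewrite /psi; case: ifP => oL.
  have h : (L./2 < L)%N by lia.
  rewrite (bigD1 (Ordinal h))//= [X in _ + X]big1 ?addr0 => [|j jL].
    by rewrite (_ : L - _ = 1)%N//; lia.
  rewrite t0 ?scaler0//; apply: contraNneq jL => e.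
  by apply/eqP/val_inj => /=; lia.
by rewrite big1// => j _; rewrite t0 ?scaler0//; apply/eqP; lia.
Qed.

(** The surviving generator is moved to the right of the monomial: e3 commutes with it and e1
    exchanges its exponents, whence the two cases of [sigma]. Nonzero real multiples of a generator
    are units. *)
Lemma mono_fun_plane k n : (n < k)%N -> exists u v : Cl, [/\ u * v = 1, v * u = 1 &
  forall x, x 0 2 = 0 -> mono_fun (k - n) n x = planar k.-1 (sigma k n) x * u].
Proof.
move=> nk; have unit (i : 'I_3) (t : R) : t != 0 ->
    (t *: cl_gen R i) * (- t^-1 *: cl_gen R i) = 1 /\
    (- t^-1 *: cl_gen R i) * (t *: cl_gen R i) = 1.
  move=> t0; rewrite -!(@scalerAl _ Cl) -!(@scalerAr _ Cl) cl_gen_sqr !scalerA.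
  by rewrite mulrN mulNr mulVf// mulfV// scaleN1r opprK.
pose q : R := - 4^-1.
have q0 j : q ^+ j != 0 by rewrite expf_neq0// oppr_eq0 invr_eq0 pnatr_eq0.
rewrite /mono_fun /sigma; case: ifP => oL.
  have [h1 h2] := unit 2 _ (q0 (k - n)./2); eexists; eexists; split; [exact: h1|exact: h2|].
  move=> x x2; rewrite !psi_plane// oL (_ : odd (k - n).-1 = false); last by lia.
  rewrite mulr0 scaler0 subr0 (_ : k.-1 - _ = (k - n)./2)%N; last by lia.
  by rewrite -!(@scalerAr _ Cl) e3Mtmon.
have h0 : - (2^-1 * q ^+ (k - n).-1./2) != 0.
  by rewrite oppr_eq0 mulf_neq0// invr_eq0 pnatr_eq0.
have [h1 h2] := unit 0 _ h0; eexists; eexists; split; [exact: h1|exact: h2|].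
move=> x x2; rewrite !psi_plane// oL (_ : odd (k - n).-1 = true); last by lia.
rewrite mulr0 sub0r (_ : k.-1 - _ = (k - n).-1./2 + n.+1)%N; last by lia.
rewrite (_ : (k - n)./2.-1 = (k - n).-1./2); last by lia.
by rewrite -!(@scalerAr _ Cl) scalerA e1Mtmon scaleNr.
Qed.

End PlaneRestriction.

(** * Jacobi polynomials and the solid harmonics *)

Section SolidHarmonics.
Variable R : realType.
Local Notation Cl := (clifford R 3).
Local Notation J := (cl_gen R (0 : 'I_3) * cl_gen R (1 : 'I_3)).

(** The coefficients of the Jacobi polynomial with equal parameters in the expansion
    [jacobi_diag]. *)
Definition jcoef (N n j : nat) : R :=
  (N + n)`!%:R / (j`!%:R * (j + n)`!%:R * (N - j.*2)`!%:R).

Lemma fact_neq0 n : n`!%:R != 0 :> R.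
Proof. by rewrite pnatr_eq0 -lt0n fact_gt0. Qed.

Lemma bin_factR m i : (i <= m)%N -> ('C(m, i)%:R : R) = m`!%:R / (i`!%:R * (m - i)`!%:R).
Proof.
move=> im; apply: (canRL (mulfK _)); first by rewrite mulf_neq0 ?fact_neq0.
by rewrite -!natrM bin_fact.
Qed.

Lemma jcoef_bin N n j s : (j <= s)%N -> (j <= N - s)%N -> (s <= N)%N ->
  jcoef N n j * 'C(N - j.*2, s - j)%:R =
  'C(N + n, s)%:R * ('C(s, j)%:R * 'C(N + n - s, N - s - j)%:R).
Proof.
move=> js jNs sN; rewrite !bin_factR ?/jcoef; try lia.
rewrite (_ : N - j.*2 - (s - j) = N - s - j)%N; last by lia.
rewrite (_ : N + n - s - (N - s - j) = j + n)%N; last by lia.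
move: (fact_neq0 j) (fact_neq0 (j + n)) (fact_neq0 (N - j.*2)) (fact_neq0 s)
  (fact_neq0 (N + n - s)) (fact_neq0 (s - j)) (fact_neq0 (N - s - j)).
by move=> *; field; do !(apply/andP; split).
Qed.

(** Vandermonde's identity for N+n = s + (N+n-s) expands the first binomial, and [jcoef_bin] matches
    the terms. The guards on [j] exclude values at which truncated subtraction could give a wrong
    binomial. *)
Lemma jcoef_vandermonde N n s : (s <= N)%N ->
  ('C(N + n, N - s) * 'C(N + n, s))%:R =
  \sum_(0 <= j < N.+1 | (j <= s)%N && (j <= N - s)%N)
     jcoef N n j * 'C(N - j.*2, s - j)%:R.
Proof.
move=> sN.
have h : ((N - s).+1 <= N.+1)%N by rewrite ltnS leq_subr.
rewrite (big_cat_nat (leq0n _) h)/= [X in _ = _ + X]big_nat_cond.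
rewrite [X in _ = _ + X]big1 ?addr0; last first.
  by move=> j /andP[/andP[a _] /andP[_ b]]; move: a b; lia.
rewrite big_nat_cond.
rewrite (eq_bigr (fun j =>
    'C(N + n, s)%:R * ('C(s, j)%:R * 'C(N + n - s, N - s - j)%:R : R))).
  rewrite -mulr_sumr mulnC natrM; congr (_ * _).
  have := binomial.Vandermonde s (N + n - s) (N - s).
  rewrite (_ : s + (N + n - s) = N + n)%N => [<-|]; last by lia.
  rewrite natr_sum -(big_mkord predT (fun j => ('C(s, j) * 'C(N + n - s, N - s - j))%:R)).
  rewrite big_nat_cond [LHS](bigID (fun j => j <= s)%N)/= [X in _ + X]big1 ?addr0.
    apply: eq_big => [j|j _]; last by rewrite natrM.
    by rewrite andbT !ltnS; case: (j <= N - s)%N; rewrite ?andbT ?andbF.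
  by move=> j /andP[_]; rewrite -ltnNge => /bin_small->; rewrite mul0n.
by move=> j /andP[_ /andP[a b]]; apply: jcoef_bin.
Qed.

(** With a = t-1 and b = t+1 one has a+b = 2t and ab = t^2-1. Expanding (a+b)^(N-2j) (ab)^j and
    collecting a^s b^(N-s) gives the sum in [jcoef_vandermonde]. *)
Lemma jacobi_diag N n (t : R) : (jacobi R N n n).[t] =
  \sum_(0 <= j < N.+1 | (j.*2 <= N)%N)
     jcoef N n j * t ^+ (N - j.*2) * ((t ^+ 2 - 1) / 4) ^+ j.
Proof.
pose a := t - 1; pose b := t + 1.
have -> : (jacobi R N n n).[t] = (2 ^+ N)^-1 * \sum_(0 <= s < N.+1)
    ('C(N + n, N - s) * 'C(N + n, s))%:R * (a ^+ s * b ^+ (N - s)).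
  rewrite /jacobi hornerZ horner_sum big_mkord; congr (_ * _).
  apply: eq_bigr => s _; rewrite hornerZ hornerM !horner_exp hornerD hornerX.
  by rewrite hornerD hornerX hornerN hornerC.
rewrite big_nat_cond.
under eq_bigr => s /andP[/andP[_ sN] _] do
  rewrite jcoef_vandermonde 1?mulr_suml //.
rewrite -big_nat_cond (exchange_big_dep_nat (fun j => j.*2 <= N)%N)/=; last first.
  by move=> s j; lia.
rewrite mulr_sumr; apply: eq_bigr => j jN.
pose M := (N - j.*2)%N.
have -> : jcoef N n j * t ^+ M * ((t ^+ 2 - 1) / 4) ^+ j =
    (2 ^+ N)^-1 * (jcoef N n j * ((b + a) ^+ M * (a * b) ^+ j)).
  have -> : t = (b + a) / 2 by rewrite /a /b; field.
  have -> : (((b + a) / 2) ^+ 2 - 1) / 4 = (a * b) / 4 by rewrite /a /b; field.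
  have -> : N = (M + j.*2)%N by rewrite subnK.
  rewrite !exprMn !exprVn exprD -mul2n exprM (_ : 2 ^+ 2 = 4 :> R); last by ring.
  by field; rewrite !expf_neq0 ?pnatr_eq0.
congr (_ * _).
(* The guards leave j <= s <= N-j, which is the index range of the binomial expansion shifted by
   [j]. *)
have hj : (j <= M.+1 + j)%N by lia.
have hN : (M.+1 + j <= N.+1)%N by rewrite /M; lia.
rewrite (big_cat_nat (leq0n j) (leq_trans hj hN))/= big_nat_cond big1 ?add0r; last first.
  by move=> i; lia.
rewrite (big_cat_nat hj hN)/= [X in _ + X]big_nat_cond [X in _ + X]big1 ?addr0; last first.
  by move=> i; rewrite /M; lia.
rewrite big_nat_cond (eq_bigl (fun i => (j <= i < M.+1 + j)%N)); last first.
  by move=> i; rewrite /M; lia.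
rewrite -big_nat -[j in LHS]add0n big_addn addnK exprDn mulr_suml mulr_sumr big_mkord.
apply: eq_bigr => i _.
rewrite addnK exprMn -mulr_natr exprD.
rewrite (_ : N - (i + j) = M - i + j)%N; last by have := ltn_ord i; rewrite /M; lia.
by rewrite exprD; ring.
Qed.

(** For t = cos phi the factor (t^2-1)/4 is -1/4 times the square of sin phi, so [jacobi_diag]
    matches [psi] term by term. *)
Lemma psi_jacobi N n r theta phi :
  r ^+ (N + n) * sin phi ^+ n * (jacobi R N n n).[cos phi] *: rotor (- (n%:R * theta)) =
  (N + n)`!%:R *: psi N.+1 n (spherical r theta phi).
Proof.
rewrite jacobi_diag /psi big_mkord.
rewrite mulr_sumr scaler_suml scaler_sumr [LHS]big_mkcond/=; apply: eq_bigr => j _.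
case: ifP => jN; last by rewrite (_ : N.+1 - j.*2 = 0)%N ?tmon0l ?scaler0//; lia.
rewrite subSn// tmon_spherical !scalerA; congr (_ *: rotor _); last by rewrite natrD; ring.
have -> : ((cos phi ^+ 2 - 1) / 4) ^+ j = (- 4^-1) ^+ j * (sin phi ^+ j * sin phi ^+ j).
  by rewrite -!exprMn; congr (_ ^+ _); rewrite cos2sin2; field.
pose M := (N - j.*2)%N.
have NM : (N + n)%N = (M + (j + n + j))%N by rewrite /M; lia.
rewrite /jcoef -/M NM !exprMn !exprD.
have := (fact_neq0 j, fact_neq0 (j + n), fact_neq0 M).
move: (- 4^-1 : R) => q [[? ?] ?]; field; do !(apply/andP; split) => //.
Qed.

(** The factorial compensates the divided powers; the denominator is the normalization of the
    harmonics. *)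
Definition kappa (k n : nat) : R :=
  k`!%:R / (if n == 0%N then Num.sqrt (8 * pi) else 2 ^+ n.+1 * Num.sqrt pi).

Lemma kappa_neq0 k n : kappa k n != 0.
Proof.
have p0 := pi_gt0 R.
rewrite /kappa mulf_neq0 ?fact_neq0// invr_eq0; case: ifP => _.
  by rewrite sqrtr_eq0 -ltNge mulr_gt0.
by rewrite mulf_neq0 ?expf_neq0 ?pnatr_eq0// sqrtr_eq0 -ltNge.
Qed.

(** [psi_jacobi] holds for all spherical coordinates, hence for the selected ones; thus a function
    defined through a choice turns out to be polynomial, also on the third axis. *)
Lemma kappa_psi0 k x : kappa k 0 *: psi k.+1 0 x = (solid_harmonic k 0 x)%:A.
Proof.
rewrite /solid_harmonic; case: spherical_coord (spherical_coordP x) => -[r theta] phi.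
case=> _ _ _ {1}->; rewrite /= /kappa/=.
have := psi_jacobi k 0 r theta phi.
rewrite addn0 expr0 mulr1 mul0r oppr0 rotor0 => h.
by rewrite [k`!%:R / _]mulrC -[LHS]scalerA -h scalerA; congr (_ *: _); ring.
Qed.

Lemma kappa_psi k n x : (0 < n <= k)%N -> kappa k n *: psi (k - n).+1 n x =
  (solid_harmonic k n.*2 x)%:A - solid_harmonic k n.*2.+1 x *: J.
Proof.
move=> /andP[n0 nk]; rewrite /solid_harmonic.
case: spherical_coord (spherical_coordP x) => -[r theta] phi.
case=> _ _ _ {1}->; rewrite /= double_eq0 -[n == 0%N]negbK -lt0n n0/= odd_double/=.
rewrite doubleK uphalf_double /kappa -[n == 0%N]negbK -lt0n n0/=.
have := psi_jacobi (k - n) n r theta phi; rewrite subnK// => h.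
rewrite [k`!%:R / _]mulrC -[LHS]scalerA -h scalerA /rotor cosN sinN scaleNr scalerBr !scalerA.
by congr (_ *: _ - _ *: _); ring.
Qed.

(** Each harmonic is the scalar part of a Clifford-valued polynomial, hence itself a polynomial.
    This justifies merging the two Dirac derivatives into that of [psi]. *)
Lemma basis_funE k n : (n < k)%N ->
  basis_fun R k n = fun x => kappa k n *: mono_fun (k - n) n x.
Proof.
move=> nk; apply/funext => x; rewrite /basis_fun.
have hp := hpolZ (kappa k n) (hpol_psi R (k - n).+1 n).
have dp : dirac_op (fun x => kappa k n *: psi (k - n).+1 n x) x =
    kappa k n *: mono_fun (k - n) n x.
  rewrite -dirac_psi (is_partial_dirac (fun j => is_partialZ _ (hpolP j x (hpol_psi R _ _)))).
  by rewrite scaler_sumr; apply: eq_bigr => j _; rewrite scalerAr.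
case: eqP dp hp => [->|/eqP]; rewrite -?lt0n.
  rewrite subn0 => dp _; rewrite -dp /dirac_harmonic.
  apply: (congr1 (fun g => dirac_op g x)).
  by apply/funext => y; rewrite kappa_psi0.
move=> n0 dp hp.
(* Conjugation fixes the scalar coordinate but sends J to -J. *)
have J0 : J finset.set0 = 0.
  have : cl_conj J finset.set0 = J finset.set0 by rewrite ffunE cards0 mul1r.
  rewrite cl_conjM !cl_conj_gen mulrNN (@cl_gen_anticomm _ _ 1 0)// ffunE.
  by lra.
have one0 : (1 : Cl) finset.set0 = 1 by rewrite -blade0 bladeE eqxx.
have nk' : (0 < n <= k)%N by rewrite n0 ltnW.
have hc : (fun y => (solid_harmonic k n.*2 y)%:A : Cl) =
    fun y => ((kappa k n *: psi (k - n).+1 n y) finset.set0)%:A.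
  apply/funext => y; rewrite (kappa_psi y nk') ffunE [X in _ + X]ffunE !cl_scaleE J0 one0.
  by rewrite mulr0 oppr0 addr0 mulr1.
(* Right multiplication by J brings the sine harmonic into the scalar coordinate. *)
have hs : (fun y => (solid_harmonic k n.*2.+1 y)%:A : Cl) =
    fun y => (((kappa k n *: psi (k - n).+1 n y) * J) finset.set0)%:A.
  apply/funext => y; rewrite (kappa_psi y nk') mulrBl mulr_algl -scalerAl sqrJ.
  rewrite scalerN opprK cl_addE !cl_scaleE J0 one0.
  by rewrite mulr0 add0r mulr1.
have Hc := hpol_coef finset.set0 hp; rewrite -hc in Hc.
have Hs := hpol_coef finset.set0 (hpolMr J hp); rewrite -hs in Hs.
rewrite -dp -(dirac_opBMr _ _ Hc Hs); apply: (congr1 (fun g => dirac_op g x)).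
by apply/funext => y; rewrite kappa_psi// mulr_algl.
Qed.

End SolidHarmonics.

(** * The orthogonal basis property of the functions F_(k-1)^n *)

Theorem theorem3p3 (R : realType) (k : nat) (hk : (1 <= k)%N) :
  right_basis (inner_monogenic R k.-1) (fun n : 'I_k => basis_fun R k n) /\
  (forall n n' : 'I_k, n <> n' ->
     sphere_integral (fun w => cl_conj (basis_fun R k n w) * basis_fun R k n' w) = 0).
Proof.
have bE (n : 'I_k) := basis_funE R (ltn_ord n).
split; last first.
  move=> n n' nn'; rewrite !bE.
  have nn : (n : nat) != n' by apply/eqP => /val_inj.
  have := sphere_nullMl (kappa R k n * kappa R k n')%:A
    (@sphere_null_mono_fun R (k - n) (k - n') _ _ nn).
  rewrite (_ : (fun w => _) = fun w => (kappa R k n * kappa R k n')%:A *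
      (cl_conj (mono_fun (k - n) n w) * mono_fun (k - n') n' w)).
    by move=> h; apply/ffunP => A; rewrite !ffunE; case: (h A).
  apply/funext => w; rewrite [cl_conj (_ *: _)]linearZ mulr_algl.
  by rewrite -(@scalerAl _ (clifford R 3)) -(@scalerAr _ (clifford R 3)) scalerA.
case: k hk bE => // K _ bE.
pose s (n : 'I_K.+1) : 'I_K.+1 := Ordinal (sigma_lt (ltn_ord n)).
(* The pair holds the unit of [mono_fun_plane] and its inverse, rescaled by [kappa] and its
   inverse. *)
have /choice[w hw] (n : 'I_K.+1) : exists w : clifford R 3 * clifford R 3,
    [/\ w.1 * w.2 = 1, w.2 * w.1 = 1 & forall x : 'rV[R]_3, x 0 2 = 0 ->
      basis_fun R K.+1 n x = tmon 1 (s n).+1 (K - s n).+1 x * w.1].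
  have [u [v [uv vu h]]] := mono_fun_plane R (ltn_ord n).
  have k0 := kappa_neq0 R K.+1 n.
  exists (kappa R K.+1 n *: u, (kappa R K.+1 n)^-1 *: v) => /=; split.
  - rewrite -(@scalerAl _ (clifford R 3)) -(@scalerAr _ (clifford R 3)).
    by rewrite scalerA mulfV// scale1r.
  - rewrite -(@scalerAl _ (clifford R 3)) -(@scalerAr _ (clifford R 3)).
    by rewrite scalerA mulVf// scale1r.
  - by move=> x x2; rewrite bE h// scalerAr.
apply: (@right_basis_of_plane R K _ s (fun n => (w n).1) (fun n => (w n).2)).
- by move=> n n' /(congr1 val)/= e; apply/val_inj/(sigma_inj _ _ e).
- move=> n; rewrite bE; split.
    apply/hpol_poly/hpolZ; have := hpol_mono_fun R (K.+1 - n) n.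
    by rewrite subnK// ltnW.
  move=> x; have h := hpol_mono_fun R (K.+1 - n) n.
  rewrite (is_partial_dirac (fun j => is_partialZ _ (hpolP j x h))).
  under eq_bigr do rewrite -scalerAr.
  by rewrite -scaler_sumr -[X in _ *: X]/(dirac_op _ x) dirac_mono_fun scaler0.
- by move=> n; case: (hw n).
- by move=> n; case: (hw n).
- by move=> n; case: (hw n).
Qed.
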